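(* Let $\alpha,M>0$ and $0<M_1<M_0$. For each sample size $n$ let $p=p_n$, $p_0=p_{0,n}$ and $k=k_n$ be positive integers with $p_0<p$, let $\epsilon_n>0$, let $\Sigma_0\in\mathcal F_{p,\alpha}(M,M_0,M_1)$, and let $Z_1,\ldots,Z_n$ be i.i.d. $N_p(0,\Sigma_0)$ with $S_n=n^{-1}\sum_{i=1}^nZ_iZ_i^T$. If $k\vee\log p=o(n)$, $\lfloor k/2\rfloor>\{4M/\lambda_{\min}(\Sigma_0)\}^{1/\alpha}$ and $\epsilon_n=O(1)$, then there exist positive constants $C,\lambda$ and $\tau$ depending only on $M,M_0,M_1$ and $\alpha$ such that $$E_{\Sigma_0}\Big(\big\|\psi(\Sigma_0)-\phi(S_n;2\lfloor ak\log k\rfloor,\epsilon_n)\big\|^2\Big)\le C\Big\{k^{-2\{\alpha\wedge(a\tau-1)\}}+\frac kn+\epsilon_n^2+\frac{p^{1/2}5^{k/2}\exp(-\lambda n)}{\epsilon_n^2}\Big\}$$ for all $a>0$ and all sufficiently large $n$, $k$ and $p_0$ with $\lfloor ak\log k\rfloor/2\ge k$ and $p_0>2\lfloor ak\log k\rfloor$.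
   Context: $\mathcal C_p$ is the set of $p\times p$ (symmetric) positive definite matrices; $\lambda_{\min},\lambda_{\max}$ are the smallest and largest eigenvalues; $\|\cdot\|$ is the spectral norm; $x\vee y=\max(x,y)$, $x\wedge y=\min(x,y)$. Bandable class: $\mathcal F_{p,\alpha}(M,M_0,M_1)=\{\Sigma=(\sigma_{ij})\in\mathcal C_p:\ \max_j\sum_{i:|i-j|\ge k}|\sigma_{ij}|\le Mk^{-\alpha}\ \forall k\ge1,\ \lambda_{\max}(\Sigma)\le M_0,\ \lambda_{\min}(\Sigma)\ge M_1\}$. Conditional mean operator: for a $p\times p$ matrix $A$, $A_{XX}$ is the block with rows $1,\ldots,p_0$ and columns $1,\ldots,p_0$, and $A_{YX}$ is the block with rows $p_0+1,\ldots,p$ and columns $1,\ldots,p_0$; $\psi(\Sigma)=\Sigma_{YX}(\Sigma_{XX})^{-1}$ for $\Sigma\in\mathcal C_p$. Tapering: $T_k(\Sigma)=(w^{(k)}_{ij}\sigma_{ij})$ with $w^{(k)}_{ij}=1$ if $|i-j|\le k/2$, $w^{(k)}_{ij}=2-\frac{|i-j|}{k/2}$ if $k/2<|i-j|<k$, and $w^{(k)}_{ij}=0$ otherwise. Blockwise tapering: for a $p_0\times p_0$ matrix $A$, an integer $1\le b\le p_0$ and $\epsilon\geq 0$, let $A_{[b]}$ be the lower-right $b\times b$ block of $A$ (rows and columns $p_0-b+1,\ldots,p_0$), and let $\Lambda^{(\epsilon)}(A;b)$ be the $p_0\times p_0$ matrix whose lower-right $b\times b$ block is $\{A_{[b]}+([\epsilon-\lambda_{\min}(A_{[b]})]\vee0)I_b\}^{-1}$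 and whose other entries are $0$. Then $\phi(\Sigma;b,\epsilon)=T_k(\Sigma)_{YX}\,\Lambda^{(\epsilon)}\{T_k(\Sigma)_{XX};b\}$, with the same $k$ as in the claim. *)

(* Defs.v *)
From HB Require Import structures.
From mathcomp Require Import all_boot all_order all_algebra.
From mathcomp Require Import all_classical all_reals all_analysis.
Set Implicit Arguments.
Unset Strict Implicit.
Unset Printing Implicit Defensive.
Import Order.TTheory GRing.Theory Num.Theory.
Import numFieldNormedType.Exports.
Local Open Scope classical_set_scope.
Local Open Scope ring_scope.

Definition euclidean_norm (R : realType) (n : nat) (x : 'cV[R]_n) : R :=
  Num.sqrt (\sum_(i < n) x i 0 ^+ 2).

Definition spectral_norm (R : realType) (m n : nat) (A : 'M[R]_(m, n)) : R :=
  sup [set euclidean_norm (A *m x) | x in [set x | euclidean_norm x <= 1]].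

(* Used only on real symmetric matrices of positive size, whose eigenvalues
   form a nonempty finite set of reals. *)
Definition lambda_min (R : realType) (n : nat) (A : 'M[R]_n) : R :=
  inf [set l : R | eigenvalue A l].

Definition lambda_max (R : realType) (n : nat) (A : 'M[R]_n) : R :=
  sup [set l : R | eigenvalue A l].

Definition posdefmx (R : realType) (n : nat) (A : 'M[R]_n) : Prop :=
  A^T = A /\ forall x : 'cV[R]_n, x != 0 -> 0 < (x^T *m A *m x) 0 0.

Definition bandable (R : realType) (alpha M M0 M1 : R) (p : nat)
    (Sigma : 'M[R]_p) : Prop :=
  [/\ posdefmx Sigma,
      forall (k : nat) (j : 'I_p), (1 <= k)%N ->
        \sum_(i < p | (k <= `|i%:Z - j%:Z|)%N) `|Sigma i j|
          <= M * k%:R `^ (- alpha),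
      lambda_max Sigma <= M0 &
      M1 <= lambda_min Sigma].

(* X is the block of the first p0 coordinates, Y that of the last q. *)
Definition psi (R : realType) (p0 q : nat) (Sigma : 'M[R]_(p0 + q)) :
    'M[R]_(q, p0) :=
  dlsubmx Sigma *m invmx (ulsubmx Sigma).

Definition taper_weight (R : realType) (k d : nat) : R :=
  if d%:R <= k%:R / 2 :> R then 1
  else if (d < k)%N then 2 - d%:R / (k%:R / 2)
  else 0.

Definition taper (R : realType) (p k : nat) (Sigma : 'M[R]_p) : 'M[R]_p :=
  \matrix_(i, j) (taper_weight R k (`|i%:Z - j%:Z|%N) * Sigma i j).

Section BlockwiseTapering.
Context (R : realType) (p0 b : nat) (hb : (b <= p0)%N).

Definition lower_right_block (A : 'M[R]_p0) : 'M[R]_b :=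
  drsubmx (castmx (esym (subnK hb), esym (subnK hb)) A : 'M[R]_(p0 - b + b)).

Definition Lambda (eps : R) (A : 'M[R]_p0) : 'M[R]_p0 :=
  let B := lower_right_block A in
  castmx (subnK hb, subnK hb)
    (block_mx 0 0 0 (invmx (B + (Num.max (eps - lambda_min B) 0)%:M))).

Definition phi (q k : nat) (eps : R) (Sigma : 'M[R]_(p0 + q)) :
    'M[R]_(q, p0) :=
  dlsubmx (taper k Sigma) *m Lambda eps (ulsubmx (taper k Sigma)).

End BlockwiseTapering.

Definition tuple_col (R : realType) (p : nat) (z : p.-tuple R) : 'cV[R]_p :=
  \col_i tnth z i.

Section GaussianSample.
Context (R : realType) (d : measure_display) (T : measurableType d)
  (P : probability T R) (p : nat).

(* Z ~ N_p(0, Sigma): every nontrivial linear form u^T Z is univariate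
   N(0, u^T Sigma u). The case u = 0 carries no information, and must be left
   out because [normal_prob m 0] is not the Dirac mass at m. *)
Definition centered_gaussian (Sigma : 'M[R]_p) (Z : {RV P >-> p.-tuple R}) :=
  forall u : 'cV[R]_p, u != 0 -> forall A : set R, measurable A ->
    pushforward P (fun w => (u^T *m tuple_col (Z w)) 0 0) A
    = normal_prob 0 (Num.sqrt ((u^T *m Sigma *m u) 0 0)) A.

Definition mutually_independent (n : nat)
    (Z : 'I_n -> {RV P >-> p.-tuple R}) :=
  forall (J : {set 'I_n}) (A : 'I_n -> set (p.-tuple R)),
    (forall i, measurable (A i)) ->
    P (\bigcap_(i in [set` J]) (Z i @^-1` A i))
    = (\prod_(i in J) P (Z i @^-1` A i))%E.

Definition iid_centered_gaussian (Sigma : 'M[R]_p) (n : nat)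
    (Z : 'I_n -> {RV P >-> p.-tuple R}) :=
  (forall i, centered_gaussian Sigma (Z i)) /\ mutually_independent Z.

Definition sample_covariance (n : nat) (Z : 'I_n -> {RV P >-> p.-tuple R})
    (w : T) : 'M[R]_p :=
  n%:R^-1 *: \sum_(i < n) (tuple_col (Z i w) *m (tuple_col (Z i w))^T).

End GaussianSample.

(* floor(a k log k): [Num.truncn] agrees with the floor on nonnegative reals,
   and a k log k >= 0 when a > 0. *)
Definition akfloor (R : realType) (a : R) (k : nat) : nat :=
  Num.truncn (a * k%:R * ln (k%:R : R)).

(* Main.v *)
Require Import Defs.
From HB Require Import structures.
From mathcomp Require Import all_boot all_order all_algebra.
From mathcomp Require Import all_classical all_reals all_analysis.
From mathcomp Require Import measurable_realfun ring lra zify.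
Import Order.TTheory GRing.Theory Num.Theory.
Import numFieldNormedType.Exports.
Local Open Scope classical_set_scope.
Local Open Scope ring_scope.

(* Write T for tapering, X for the first p0 coordinates, E for the embedding of
   the last b coordinates of X, and D = S_n - Sigma_0.

   Bias. Comparing psi(Sigma) with H = T(Sigma)_YX E (E^T T(Sigma)_XX E)^-1 E^T,
   the error is (Sigma - T(Sigma)), of order k^-alpha by the row sums, plus the
   product of T(Sigma)_YX E, supported on the last k columns, the inverse of a
   well conditioned k-banded b x b matrix, and a matrix supported on the first k
   rows. Entries of such an inverse decay like rho^(distance / k), and the
   distance is about 2 a k log k, which gives a power k^(- a tau).

   Noise. The taper weights are a difference of two averages of indicators of
   windows of length k, so T(D) is controlled, on the corner of T that phi
   sees, by the quadratic forms of D on b + k windows. A lattice 1/4-net of the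
   unit ball of R^k with exp(O(k)) points reduces these to finitely many u^T D u,
   each an average of centred squares of univariate Gaussians. Bounding the
   maximum by the sum of exponential moments yields a second moment O(k / n) and
   an exponentially small contribution of the event where E^T T(S_n)_XX E is
   badly conditioned; there phi is only O(1 / eps). As k = o(n), the factors
   exp(O(k)) are absorbed by exp(- lambda n). *)

(** The deterministic and the random half meet in one number [y], a common bound on the quadratic
    forms of [D] at the net points: [conditional_mean_error] bounds the loss in terms of [y]
    pointwise, and [expectation_le_of_deviation] integrates any such bound. Only these quadratic
    forms have to be measurable. The size of the net depends on [b] and [k] but not on [p], and it
    is exponential in [k] once [b + k <= exp k]. That threshold depends on [a], which is why [K1] is
    chosen after [a] while the three constants precede it. The lower bound on [k./2] makes the
    tapering error at most a quarter of [lambda_min], so the tapered matrix stays above [3/4 * M1].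
    Noise below [M1 / 4] then leaves [M1 / 2]. Passing from the net to an operator bound costs a
    factor 6, namely 2 for the net and 3 for the windows, hence the threshold [y = M1 / 24]. Two
    slopes of exponential moments are used: one of order [sqrt (k * n)] for the typical size
    [k / n], and one of order [n] for the bad event. *)

Set Implicit Arguments.
Unset Strict Implicit.
Unset Printing Implicit Defensive.

(** * Integration and independence *)

Section Transfer.
Local Open Scope ereal_scope.
Import HBNNSimple.

(* Neither function need be measurable, so that a bound on the spectral norm can
   be integrated without proving that it is a random variable. *)
Lemma ge0_le_integral_nonmeasurable d (T : measurableType d) (R : realType)
    (mu : {measure set T -> \bar R}) (f g : T -> \bar R) :
  (forall x, 0 <= f x) -> (forall x, f x <= g x) ->
  \int[mu]_x f x <= \int[mu]_x g x.
Proof.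
move=> f0 fg; rewrite !ge0_integralTE//; last by move=> x; exact: le_trans (fg x).
apply: ereal_sup_le => _ [h hf <-]; exists h => // x.
exact: le_trans (hf x) (fg x).
Qed.

(** Equality on sets passes to simple functions by linearity, then to nonnegative functions by
    monotone convergence. It serves three purposes: the normal density against Lebesgue measure ([Y]
    the identity), the law of a linear form ([h = 1]), and the isolation of one independent factor
    ([h] the product of the others). *)
Lemma ge0_integral_density d d' (X : measurableType d) (U : measurableType d')
    (R : realType) (mu : {measure set X -> \bar R})
    (nu : {measure set U -> \bar R}) (Y : X -> U) (h : X -> R)
    (g : U -> R) :
  measurable_fun setT Y -> measurable_fun setT h -> (forall x, (0 <= h x)%R) ->
  (forall A, measurable A -> \int[mu]_x (h x * \1_A (Y x))%:E = nu A) ->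
  measurable_fun setT g -> (forall u, (0 <= g u)%R) ->
  \int[mu]_x (h x * g (Y x))%:E = \int[nu]_u (g u)%:E.
Proof.
move=> mY mh h0 hnu mg g0.
have meg : measurable_fun setT (EFin \o g) by exact/measurable_EFinP.
pose g_ := nnsfun_approx measurableT meg.
have cg u : EFin \o g_^~ u @ \oo --> (g u)%:E.
  by apply: (cvg_nnsfun_approx _ meg) => // x _; rewrite lee_fin.
have ndg m n u : (m <= n)%N -> (g_ m u <= g_ n u)%R.
  by move=> mn; exact/lefP/nd_nnsfun_approx.
have mgY n : measurable_fun setT (fun x => g_ n (Y x)).
  by apply: measurableT_comp.
transitivity (limn (fun n => \int[mu]_x (h x * g_ n (Y x))%:E)).
  rewrite -monotone_convergence//.
  - apply: eq_integral => x _; apply/esym/cvg_lim => //=.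
    under eq_fun do rewrite EFinM.
    by rewrite EFinM; apply: cvgeZl => //; exact: cg.
  - by move=> n; apply/measurable_EFinP; exact: measurable_funM.
  - by move=> n x _; rewrite lee_fin mulr_ge0.
  - by move=> x _ m n mn; rewrite lee_fin ler_wpM2l// ndg.
transitivity (limn (fun n => \int[nu]_u (g_ n u)%:E)); last first.
  rewrite -monotone_convergence//.
  - by apply: eq_integral => x _; apply/cvg_lim => //=; exact: cg.
  - by move=> n; apply/measurable_EFinP.
  - by move=> n x _; rewrite lee_fin.
  - by move=> x _ m n mn; rewrite lee_fin ndg.
congr (limn _); apply/funext => n.
have mA r : measurable (g_ n @^-1` [set r]).
  by rewrite -[X in measurable X]setTI; exact: (measurable_funP (g_ n)).
have mind r : measurable_fun setT (fun x => \1_(g_ n @^-1` [set r]) (Y x) : R).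
  have mi : measurable_fun setT (\1_(g_ n @^-1` [set r]) : U -> R).
    exact: measurable_indic.
  exact: (measurableT_comp mi mY).
have ind0 r u : (0 <= r * \1_(g_ n @^-1` [set r]) u)%R.
  rewrite indicE; case: (boolP (u \in _)) => [|_]; last by rewrite mulr0.
  by rewrite inE /= => <-; rewrite mulr1.
transitivity (\int[mu]_x
    (\sum_(r \in range (g_ n)) (h x * (r * \1_(g_ n @^-1` [set r]) (Y x)))%:E)).
  apply: eq_integral => x _.
  by rewrite (fimfunE (g_ n) (Y x)) fsumEFin// mulr_fsumr.
transitivity (\int[nu]_u
    (\sum_(r \in range (g_ n)) (r * \1_(g_ n @^-1` [set r]) u)%:E)); last first.
  by apply: eq_integral => x _; rewrite (fimfunE (g_ n) x) fsumEFin.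
rewrite !ge0_integral_fsum//; last 4 first.
- by move=> r; apply/measurable_EFinP; apply: measurable_funM => //; exact: measurable_indic.
- by move=> r x _; rewrite lee_fin ind0.
- move=> r; apply/measurable_EFinP; apply: measurable_funM => //.
  exact: measurable_funM.
- by move=> r x _; rewrite lee_fin mulr_ge0.
apply: eq_fsbigr => r; rewrite inE => -[u _ ur].
have r0 : (0 <= r)%R by rewrite -ur.
under eq_integral do rewrite mulrCA EFinM.
rewrite ge0_integralZl//; last 2 first.
  by apply/measurable_EFinP; exact: measurable_funM.
  by move=> x _; rewrite lee_fin mulr_ge0.
rewrite hnu//.
under eq_integral do rewrite EFinM.
rewrite ge0_integralZl//.
  by rewrite integral_indic// setIT.
by apply/measurable_EFinP; exact: measurable_indic.
Qed.

End Transfer.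

Section Independence.
Context (R : realType) (d : measure_display) (T : measurableType d)
  (P : probability T R) (p n : nat) (Z : 'I_n -> {RV P >-> p.-tuple R}).

Lemma independent_expectation_prod (f : 'I_n -> p.-tuple R -> R) (c : 'I_n -> R) :
  mutually_independent Z ->
  (forall i, measurable_fun setT (f i)) -> (forall i z, 0 <= f i z) ->
  (forall i, (\int[P]_w (f i (Z i w))%:E = (c i)%:E)%E) ->
  (\int[P]_w (\prod_i f i (Z i w))%:E = (\prod_i c i)%:E)%E.
Proof.
move=> indep mf f0 fc.
have c0 i : 0 <= c i.
  by rewrite -lee_fin -fc; apply: integral_ge0 => w _; rewrite lee_fin.
pose G m (A : 'I_n -> set (p.-tuple R)) (i : 'I_n) : p.-tuple R -> R :=
  if (i < m)%N then f i else \1_(A i).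
pose cc m (A : 'I_n -> set (p.-tuple R)) (i : 'I_n) :=
  if (i < m)%N then c i else fine (P (Z i @^-1` A i)).
have mZA i A : measurable A -> measurable (Z i @^-1` A).
  by move=> mA; rewrite -[X in measurable X]setTI; exact: (measurable_funP (Z i)).
have mG m A i : (forall i, measurable (A i)) -> measurable_fun setT (G m A i).
  by move=> mA; rewrite /G; case: ifP => // _; exact: measurable_indic.
have G0 m A i z : 0 <= G m A i z by rewrite /G; case: ifP.
have cc0 m A i : 0 <= cc m A i.
  by rewrite /cc; case: ifP => // _; rewrite fine_ge0.
(* The indicators [\1_(A i)] are traded for the [f i] one coordinate at a time;
   each exchange is [ge0_integral_density]. *)
suff key m : (m <= n)%N -> forall A, (forall i, measurable (A i)) ->
    (\int[P]_w (\prod_i G m A i (Z i w))%:E = (\prod_i cc m A i)%:E)%E.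
  have := key n (leqnn n) (fun=> setT) (fun=> measurableT).
  under eq_integral do under eq_bigr do rewrite /G ltn_ord.
  by under [in X in _ = X -> _]eq_bigr do rewrite /cc ltn_ord.
elim: m => [_ A mA|m IH mn A mA].
  transitivity (\int[P]_w (\1_(\bigcap_(i in [set` (finset.setTfor 'I_n)]) (Z i @^-1` A i)) w)%:E)%E.
    apply: eq_integral => w _; congr EFin; rewrite indicE.
    case: (boolP (w \in _)) => [|]; rewrite ?inE ?notin_setE => H.
      rewrite big1// => i _; rewrite /G ltn0 indicE mem_set//.
      by apply: (H i); rewrite /= inE.
    have [i Hi] : exists i, ~ A i (Z i w).
      by apply: contra_notP H => /forallNP H i _ /=; apply: contrapT; exact: H.
    by rewrite (bigD1 i)//= /G ltn0 indicE memNset// mul0r.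
  rewrite integral_indic//; last first.
    apply: fin_bigcap_measurable => [|i _]; last exact: mZA.
    exact: finite_finset.
  rewrite setIT; apply: (etrans (indep (finset.setTfor 'I_n) A mA)).
  rewrite -prodEFin big_mkcond/=; apply: eq_bigr => i _.
  by rewrite inE /cc ltn0 fineK// fin_num_measure//; exact: mZA.
pose j := Ordinal mn.
pose h w := \prod_(i | i != j) G m A i (Z i w).
have mh : measurable_fun setT h.
  have -> : h = fun w => \prod_i if i != j then G m A i (Z i w) else 1.
    by apply/funext => w; exact: big_mkcond.
  apply: measurable_prod => i _; case: (i != j) => //.
  by apply: measurableT_comp => //; exact: mG.
have h0 w : 0 <= h w by apply: prodr_ge0.
pose c' := \prod_(i | i != j) cc m A i.
have c'0 : 0 <= c' by apply: prodr_ge0.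
have cc_ne B i : i != j -> cc m.+1 A i = cc m (fun i' => if i' == j then B else A i') i.
  move=> ij; rewrite /cc (negbTE ij) ltnS leq_eqVlt.
  by case: eqP => // im; move/eqP: ij; case; exact: val_inj.
have G_ne B i : i != j -> G m.+1 A i = G m (fun i' => if i' == j then B else A i') i.
  move=> ij; rewrite /G (negbTE ij) ltnS leq_eqVlt.
  by case: eqP => // im; move/eqP: ij; case; exact: val_inj.
(* The induction hypothesis, with an arbitrary [B] in position [j], says that weighting [P] by [h]
   turns the law of [Z j] into its multiple by [c']. This allows [f j] in place of [\1_B]. *)
pose nu : {measure set (p.-tuple R) -> \bar R} :=
  mscale (NngNum c'0) (distribution P (Z j)).
have hnu B : measurable B -> (\int[P]_w (h w * \1_B (Z j w))%:E = nu B)%E.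
  move=> mB; pose A' i' := if i' == j then B else A i'.
  have mA' i : measurable (A' i) by rewrite /A'; case: ifP.
  have := IH (ltnW mn) A' mA'.
  rewrite (bigD1 j)//= {1}/cc ltnn /A' eqxx -/A'.
  rewrite (eq_bigr (cc m A)); last by move=> i /negbTE ij; rewrite /cc /A' ij.
  rewrite -/c' mulrC EFinM fineK; last by rewrite fin_num_measure//; exact: mZA.
  move=> H; apply: etrans H; apply: eq_integral => w _; congr EFin.
  rewrite [in RHS](bigD1 j)//= {1}/G ltnn {1}/A' eqxx mulrC; congr (_ * _).
  by apply: eq_bigr => i /negbTE ij; rewrite /G /A' ij.
have := @ge0_integral_density _ _ _ _ R P nu (Z j) h (f j)
  (measurable_funP (Z j)) mh h0 hnu (mf j) (f0 j).
rewrite ge0_integral_mscale//; last 2 first.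
- by apply/measurable_EFinP; exact: mf.
- by move=> z _; rewrite lee_fin.
rewrite ge0_integral_pushforward//; last 2 first.
- by apply/measurable_EFinP; exact: mf.
- by move=> z _; rewrite lee_fin.
rewrite preimage_setT /= fc -EFinM => Hj.
rewrite [in RHS](bigD1 j)//= {1}/cc leqnn mulrC.
rewrite (eq_bigr (cc m A)); last by move=> i ij; rewrite (cc_ne setT) ///cc (negbTE ij).
rewrite -/c' -Hj; apply: eq_integral => w _; congr EFin.
rewrite [in LHS](bigD1 j)//= {1}/G leqnn mulrC; congr (_ * _).
by apply: eq_bigr => i ij; rewrite (G_ne setT) ///G (negbTE ij).
Qed.

End Independence.

(** * Exponential moments of Gaussian quadratic forms *)

Section GaussianQuadratic.
Context (R : realType).
Notation mu := lebesgue_measure.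

Lemma invr_1B_le_expR (y : R) : `|y| <= 2^-1 ->
  (1 - y)^-1 <= expR (y + 2 * y ^+ 2).
Proof.
rewrite ler_norml => /andP[y1 y2].
apply: le_trans (expR_ge1Dx _).
have y3 : 0 < 1 - y by lra.
rewrite -[leLHS]mul1r ler_pdivrMr// -subr_ge0.
rewrite (_ : _ - 1 = y ^+ 2 * (1 - 2 * y)); last by ring.
by rewrite mulr_ge0 ?sqr_ge0//; lra.
Qed.

(** The factor [expR (s * y ^+ 2)] only rescales the Gaussian: the integrand is [c] times the normal
    density with standard deviation [c * sg], where [c ^+ 2 = (1 - 2 * (s * v))^-1]. *)
Lemma integral_normal_expR_sqr (v s : R) : 0 < v -> s * v <= 4^-1 ->
  (\int[normal_prob 0 (Num.sqrt v)]_y (expR (s * y ^+ 2))%:E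
    = (Num.sqrt (1 - 2 * (s * v))^-1)%:E)%E.
Proof.
move=> v0 sv.
have D0 : 0 < 1 - 2 * (s * v) by lra.
set sg := Num.sqrt v.
have sg0 : 0 < sg by rewrite sqrtr_gt0.
have sg2 : sg ^+ 2 = v by rewrite sqr_sqrtr// ltW.
set c := Num.sqrt _.
have c0 : 0 < c by rewrite sqrtr_gt0 invr_gt0.
have c2 : c ^+ 2 = (1 - 2 * (s * v))^-1 by rewrite sqr_sqrtr// invr_ge0 ltW.
have mg : measurable_fun setT (fun y : R => expR (s * y ^+ 2)).
  apply: measurableT_comp => //; apply: measurable_funM => //.
have hnu A : measurable A ->
    (\int[mu]_x (normal_pdf 0 sg x * \1_A x)%:E = normal_prob 0 sg A)%E.
  move=> mA; rewrite /normal_prob [RHS]integral_mkcond.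
  apply: eq_integral => x _.
  rewrite patchE indicE; case: (x \in A); first by rewrite mulr1.
  by rewrite mulr0.
have := @ge0_integral_density _ _ _ _ R mu (normal_prob 0 sg) id
  (normal_pdf 0 sg) _ (@measurable_id _ _ _) (measurable_normal_pdf 0 sg)
  (normal_pdf_ge0 0 sg) hnu mg (fun u => expR_ge0 _).
move=> <-.
transitivity (\int[mu]_x (c%:E * (normal_pdf 0 (c * sg) x)%:E))%E.
  apply: eq_integral => x _ /=; rewrite -EFinM; congr EFin.
  rewrite !normal_pdfE ?mulf_neq0 ?gt_eqF//.
  rewrite /normal_peak /normal_fun.
  rewrite -mulrA -expRD [RHS]mulrA; congr (_ * expR _); last first.
    rewrite subr0 exprMn c2 sg2; field.
    by rewrite gt_eqF// gt_eqF.
  rewrite -!mulrnAr (sqrtrM _ (sqr_ge0 sg)) (sqrtrM _ (sqr_ge0 (c * sg))).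
  rewrite !sqrtr_sqr !gtr0_norm ?mulr_gt0//.
  by rewrite !invfM !mulrA divff ?mul1r// gt_eqF.
rewrite ge0_integralZl//; last 3 first.
- by apply/measurable_EFinP; exact: measurable_normal_pdf.
- by move=> x _; rewrite lee_fin normal_pdf_ge0.
- by rewrite lee_fin ltW.
by rewrite integral_normal_pdf mule1.
Qed.
End GaussianQuadratic.

Definition qf (R : realType) (p : nat) (A : 'M[R]_p) (u : 'cV[R]_p) : R :=
  (u^T *m A *m u) 0 0.

Section SampleCovariance.
Context (R : realType) (d : measure_display) (T : measurableType d)
  (P : probability T R) (p : nat) (Sigma : 'M[R]_p).

Lemma measurable_linear_form (u : 'cV[R]_p) :
  measurable_fun setT (fun z : p.-tuple R => (u^T *m tuple_col z) 0 0).
Proof.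
have -> : (fun z : p.-tuple R => (u^T *m tuple_col z) 0 0)
    = fun z => \sum_i u i 0 * tnth z i.
  by apply/funext => z; rewrite mxE; apply: eq_bigr => i _; rewrite !mxE.
apply: measurable_sum => i; apply: measurable_funM => //.
exact: measurable_tnth.
Qed.

Lemma gaussian_sqr_mgf (Z : {RV P >-> p.-tuple R}) (u : 'cV[R]_p) (s : R) :
  centered_gaussian Sigma Z -> u != 0 -> 0 < qf Sigma u ->
  s * qf Sigma u <= 4^-1 ->
  (\int[P]_w (expR (s * ((u^T *m tuple_col (Z w)) 0 0 ^+ 2 - qf Sigma u)))%:E
   = (expR (- (s * qf Sigma u)) * Num.sqrt (1 - 2 * (s * qf Sigma u))^-1)%:E)%E.
Proof.
move=> gZ u0 v0 sv; set v := qf Sigma u in v0 sv *.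
pose Y w := (u^T *m tuple_col (Z w)) 0 0.
have mY : measurable_fun setT Y.
  exact: (measurableT_comp (measurable_linear_form u) (measurable_funP Z)).
have mg : measurable_fun setT (fun y : R => (expR (s * y ^+ 2))%:E).
  apply/measurable_EFinP; apply: measurableT_comp => //.
  exact: measurable_funM.
have meY : measurable_fun setT (fun w => (expR (s * Y w ^+ 2))%:E).
  exact: (measurableT_comp mg mY).
under eq_integral do rewrite mulrBr addrC expRD EFinM.
rewrite ge0_integralZl//.
rewrite [RHS]EFinM; congr (_ * _)%E.
rewrite -integral_normal_expR_sqr//.
have hnu A : measurable A ->
    (\int[P]_w (1 * \1_A (Y w))%:E = normal_prob 0 (Num.sqrt v) A)%E.
  move=> mA; under eq_integral do rewrite mul1r.
  transitivity (\int[P]_w (\1_(Y @^-1` A) w)%:E)%E; first by [].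
  rewrite integral_indic// ?setIT; first exact: (gZ u u0 A mA).
  by rewrite -[X in measurable X]setTI; exact: mY.
rewrite -(@ge0_integral_density _ _ _ _ R P (normal_prob 0 (Num.sqrt v)) Y
  (fun=> 1) (fun y => expR (s * y ^+ 2)))//.
- by apply: eq_integral => w _; rewrite mul1r.
- by apply: measurableT_comp => //; exact: measurable_funM.
Qed.

(** After squaring, the linear term of the bound on [(1 - 2 * (s * v))^-1] cancels against the
    centring. The exponent left is quadratic in [s], which gives the sub-Gaussian rate for small
    slopes. *)
Lemma gaussian_sqr_mgf_le (v s : R) : `|s * v| <= 4^-1 ->
  expR (- (s * v)) * Num.sqrt (1 - 2 * (s * v))^-1 <= expR (4 * (s * v) ^+ 2).
Proof.
move=> sv.
have h := @invr_1B_le_expR R (2 * (s * v)).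
have : `|2 * (s * v)| <= 2^-1 by rewrite normrM gtr0_norm//; lra.
move=> /h {}h.
rewrite -[leRHS](@ger0_norm _ (expR _)) ?expR_ge0// -sqrtr_sqr.
rewrite -[X in X * _](@ger0_norm _ (expR _)) ?expR_ge0// -sqrtr_sqr.
rewrite -sqrtrM ?sqr_ge0// ler_sqrt ?sqr_ge0//.
apply: le_trans (_ : expR (- (s * v)) ^+ 2 * expR (2 * (s * v) + 2 * (2 * (s * v)) ^+ 2) <= _).
  by rewrite ler_pM2l// exprn_gt0// expR_gt0.
rewrite -!expRM_natl -expRD ler_expR.
rewrite le_eqVlt; apply/orP; left; apply/eqP; ring.
Qed.

Context (n : nat) (Z : 'I_n -> {RV P >-> p.-tuple R}).

Lemma qf_sample_covariance (u : 'cV[R]_p) w : (0 < n)%N ->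
  qf (sample_covariance Z w - Sigma) u =
  n%:R^-1 * \sum_i ((u^T *m tuple_col (Z i w)) 0 0 ^+ 2 - qf Sigma u).
Proof.
move=> n0; rewrite /qf mulmxBr mulmxBl mxE [X in _ + X]mxE.
rewrite sumrB mulrBr sumr_const card_ord -[X in _ - _ * X]mulr_natl mulrA mulVf ?mul1r; last first.
  by rewrite pnatr_eq0 -lt0n.
congr (_ - _); rewrite /sample_covariance -scalemxAr -scalemxAl mxE; congr (_ * _).
rewrite mulmx_sumr mulmx_suml summxE; apply: eq_bigr => i _.
rewrite mulmxA -(mulmxA (u^T *m _)) -{2}[u]trmxK -trmx_mul.
by rewrite mxE big_ord1 [X in _ * X]mxE.
Qed.

Lemma measurable_qf_sample_covariance (u : 'cV[R]_p) : (0 < n)%N ->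
  measurable_fun setT (fun w => qf (sample_covariance Z w - Sigma) u).
Proof.
move=> n0; under eq_fun do rewrite qf_sample_covariance//.
apply: measurable_funM => //; apply: measurable_sum => i.
apply: measurable_funB => //; apply: measurable_funX.
exact: (measurableT_comp (measurable_linear_form u) (measurable_funP (Z i))).
Qed.

Lemma sample_covariance_mgf_le (u : 'cV[R]_p) (V theta : R) :
  iid_centered_gaussian Sigma Z -> (0 < n)%N ->
  (u != 0 -> 0 < qf Sigma u) -> qf Sigma u <= V ->
  `|theta| * V <= n%:R / 4 ->
  (\int[P]_w (expR (theta * qf (sample_covariance Z w - Sigma) u))%:E
   <= (expR (4 * theta ^+ 2 * V ^+ 2 / n%:R))%:E)%E.
Proof.
move=> [gZ iZ] n0 pd vV tV.
have n0R : 0 < n%:R :> R by rewrite ltr0n.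
(* The null vector does occur: the net contains the origin, and a window may fall outside the
   matrix. [centered_gaussian] is silent there, but the quadratic form vanishes. *)
have [->|u0] := eqVneq u 0.
  under eq_integral do rewrite /qf mulmx0 mxE mulr0 expR0.
  rewrite integral_cst// [X in (_ * X)%E]probability_setT mule1 lee_fin -expR0 ler_expR.
  by apply: divr_ge0 => //; apply: mulr_ge0; rewrite ?sqr_ge0// mulr_ge0 ?sqr_ge0.
have v0 := pd u0; set v := qf Sigma u in v0 vV *.
set s := theta / n%:R.
have sv : `|s * v| <= 4^-1.
  rewrite /s normrM normrM (gtr0_norm v0) normfV (gtr0_norm n0R).
  rewrite mulrAC ler_pdivrMr// mulrC [leRHS]mulrC.
  apply: le_trans tV; rewrite mulrC; apply: ler_wpM2l => //.
pose f (i : 'I_n) (z : p.-tuple R) :=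
  expR (s * ((u^T *m tuple_col z) 0 0 ^+ 2 - v)).
have mf i : measurable_fun setT (f i).
  apply: measurableT_comp => //; apply: measurable_funM => //.
  apply: measurable_funB => //; apply: measurable_funX.
  exact: measurable_linear_form.
have := @independent_expectation_prod R d T P p n Z f
  (fun=> expR (- (s * v)) * Num.sqrt (1 - 2 * (s * v))^-1) iZ mf
  (fun i z => expR_ge0 _) (fun i => gaussian_sqr_mgf (gZ i) u0 v0
     (le_trans (ler_norm _) sv)).
move=> E.
under eq_integral => w _.
  rewrite qf_sample_covariance// mulrA mulr_sumr expR_sum.
  over.
rewrite E lee_fin prodr_const card_ord.
apply: le_trans (_ : expR (4 * (s * v) ^+ 2) ^+ n <= _).
  rewrite lerXn2r ?nnegrE ?expR_ge0 ?mulr_ge0 ?expR_ge0 ?sqrtr_ge0//.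
  exact: gaussian_sqr_mgf_le.
rewrite -expRM_natl ler_expR.
rewrite (_ : _ * _ = 4 * theta ^+ 2 / n%:R * v ^+ 2); last first.
  by rewrite /s; field; rewrite gt_eqF.
rewrite (_ : 4 * _ * _ / _ = 4 * theta ^+ 2 / n%:R * V ^+ 2); last first.
  by field; rewrite gt_eqF.
apply: ler_wpM2l; first by apply: divr_ge0 => //; rewrite mulr_ge0 ?sqr_ge0.
by rewrite lerXn2r// nnegrE ltW// (lt_le_trans v0).
Qed.

End SampleCovariance.

(** Beyond [s >= 2] the logarithmic derivative [2 / y] of the square is at most 1, so the
    exponential overtakes it. The cut-off level [s] is kept free so that [expR (- s)] can pay for
    the cardinality of the net. *)
Lemma sqr_le_sqr_expR (R : realType) (s y : R) : 2 <= s -> 0 <= y ->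
  y ^+ 2 <= s ^+ 2 * (1 + expR (y - s)).
Proof.
move=> s2 y0; have s0 : 0 < s by lra.
have [ys|sy] := leP y s.
  apply: le_trans (_ : s ^+ 2 * 1 <= _).
    by rewrite mulr1 lerXn2r// nnegrE ltW.
  by rewrite ler_pM2l ?exprn_gt0// lerDl expR_ge0.
apply: le_trans (_ : s ^+ 2 * expR (y - s) <= _); last first.
  by rewrite ler_pM2l ?exprn_gt0// lerDr.
have -> : y - s = 2 * ((y - s) / 2) by field.
rewrite expRM_natl mulrC -exprMn.
rewrite lerXn2r ?nnegrE ?mulr_ge0 ?expR_ge0 ?(ltW s0)//.
apply: le_trans (_ : (1 + (y - s) / 2) * s <= _).
  rewrite -subr_ge0 (_ : _ - _ = (y - s) * (s - 2) / 2); last by field.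
  by rewrite divr_ge0// mulr_ge0//; lra.
by rewrite ler_pM2r// expR_ge1Dx.
Qed.

Lemma sqr_le_expR (R : realType) (y : R) : 0 <= y -> y ^+ 2 <= 4 * expR y.
Proof.
move=> y0.
have h := expR_ge1Dx (y / 2); have -> : y = 2 * (y / 2) by field.
rewrite expRM_natl; set e := expR _ in h *.
apply: le_trans (_ : 4 * (1 + y / 2) ^+ 2 <= _); first by nra.
by rewrite ler_pM2l// lerXn2r// nnegrE; lra.
Qed.

(** * From exponential moments to an expected loss *)

Section Deviation.
Context (R : realType) (d : measure_display) (T : measurableType d)
  (P : probability T R) (p n : nat) (Sigma : 'M[R]_p)
  (Z : 'I_n -> {RV P >-> p.-tuple R}) (I : finType) (x : I -> 'cV[R]_p) (V : R).
Hypotheses (hZ : iid_centered_gaussian Sigma Z) (n0 : (0 < n)%N)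
  (pd : forall u, u != 0 -> 0 < qf Sigma u) (hV : forall i, qf Sigma (x i) <= V).

Let q i w := qf (sample_covariance Z w - Sigma) (x i).

(** A measurable majorant of the exponential of the maximum; the summand 1 accounts for the default
    value 0 of that maximum. *)
Let soft theta w := 1 + \sum_i expR (theta * `|q i w|).

Let m w := \big[Num.max/0]_i `|q i w|.

Let measurable_q i : measurable_fun setT (q i).
Proof. exact: measurable_qf_sample_covariance. Qed.

Let measurable_expRq theta i :
  measurable_fun setT (fun w => (expR (theta * `|q i w|))%:E).
Proof.
have h : measurable_fun setT (fun w => expR (theta * `|q i w|)).
  apply: measurableT_comp => //; apply: measurable_funM => //.
  by apply: measurableT_comp => //; exact: measurable_q.
exact/measurable_EFinP.
Qed.

Let measurable_soft theta : measurable_fun setT (fun w => (soft theta w)%:E).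
Proof.
have h : measurable_fun setT (soft theta).
  apply: measurable_funD => //; apply: measurable_sum => i.
  by apply/measurable_EFinP; exact: measurable_expRq.
exact/measurable_EFinP.
Qed.

Let soft_ge0 theta w : 0 <= soft theta w.
Proof. by rewrite addr_ge0// sumr_ge0// => i _; exact: expR_ge0. Qed.

Let expRm_le_soft theta w : 0 <= theta -> expR (theta * m w) <= soft theta w.
Proof.
move=> t0; rewrite /m.
elim/big_ind: _ => [|y z hy hz|i _].
- by rewrite mulr0 expR0 lerDl sumr_ge0// => i _; exact: expR_ge0.
- by rewrite /Num.max; case: ifP.
- by rewrite /soft (bigD1 i)//= addrCA lerDl addr_ge0// sumr_ge0.
Qed.

Let expectation_expRq theta i : 0 <= theta -> theta * V <= n%:R / 4 ->
  (\int[P]_w (expR (theta * `|q i w|))%:E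
    <= (2 * expR (4 * theta ^+ 2 * V ^+ 2 / n%:R))%:E)%E.
Proof.
move=> t0 tV.
have mE t : measurable_fun setT (fun w => (expR (t * q i w))%:E).
  apply/measurable_EFinP; apply: measurableT_comp => //.
  exact: measurable_funM.
have E t : `|t| = theta -> (\int[P]_w (expR (t * q i w))%:E
    <= (expR (4 * theta ^+ 2 * V ^+ 2 / n%:R))%:E)%E.
  move=> tt; have := @sample_covariance_mgf_le R d T P p Sigma n Z (x i) V t hZ n0
    (@pd (x i)) (hV i).
  rewrite tt => /(_ tV); rewrite (_ : t ^+ 2 = theta ^+ 2)//.
  by rewrite -tt -normrX ger0_norm// sqr_ge0.
apply: (@le_trans _ _ (\int[P]_w ((expR (theta * q i w))%:E + (expR (- theta * q i w))%:E))%E).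
  apply: ge0_le_integral_nonmeasurable => w; first by rewrite lee_fin expR_ge0.
  rewrite -EFinD lee_fin; have [q0|q0] := leP 0 (q i w).
    by rewrite ger0_norm// lerDl expR_ge0.
  by rewrite ltr0_norm// mulrN mulNr lerDr expR_ge0.
rewrite ge0_integralD//.
rewrite mulr_natl mulr2n EFinD; apply: leeD; apply: E; first exact: ger0_norm.
by rewrite normrN ger0_norm.
Qed.

Let expectation_soft theta : 0 <= theta -> theta * V <= n%:R / 4 ->
  (\int[P]_w (soft theta w)%:E
    <= (1 + 2 * #|I|%:R * expR (4 * theta ^+ 2 * V ^+ 2 / n%:R))%:E)%E.
Proof.
move=> t0 tV; under eq_integral do rewrite EFinD -sumEFin.
rewrite ge0_integralD//; last 2 first.
- by move=> w _; apply: sume_ge0 => i _; rewrite lee_fin expR_ge0.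
- exact: emeasurable_sum.
rewrite integral_cst// [X in (_ * X)%E]probability_setT mule1 EFinD leeD2l//.
rewrite ge0_integral_sum//.
apply: (@le_trans _ _ (\sum_(i : I) (2 * expR (4 * theta ^+ 2 * V ^+ 2 / n%:R))%:E)%E).
  by apply: lee_sum => i _; exact: expectation_expRq.
by rewrite sumEFin sumr_const -[_ *+ #|_|]mulr_natl lee_fin mulrA [_ * 2]mulrC.
Qed.

(** The loss is dominated pointwise by two copies of [soft]: slope [th2], with cut-off [s], controls
    the second moment, and slope [2 * th1] controls the event where the maximum exceeds [t0]. *)
Lemma expectation_le_of_deviation (err : T -> R) (a b c t0 s th1 th2 : R) :
  (forall w, 0 <= err w) ->
  (forall w y, (forall i, `|q i w| <= y) -> 0 <= y ->
    err w <= a + b * y ^+ 2 + c * (if t0 < y then 1 + 36 * y ^+ 2 else 0)) ->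
  0 <= a -> 0 <= b -> 0 <= c -> 2 <= s -> 1 <= th1 -> 0 < th2 ->
  2 * th1 * V <= n%:R / 4 -> th2 * V <= n%:R / 4 ->
  (\int[P]_w (err w)%:E <=
   (a + b * (s ^+ 2 / th2 ^+ 2 * (1 + expR (- s) *
        (1 + 2 * #|I|%:R * expR (4 * th2 ^+ 2 * V ^+ 2 / n%:R))))
      + c * (145 * expR (- (th1 * t0)) *
        (1 + 2 * #|I|%:R * expR (4 * (2 * th1) ^+ 2 * V ^+ 2 / n%:R))))%:E)%E.
Proof.
move=> err0 errle a0 b0 c0 s2 t1 t2 tV1 tV2.
pose C1 := b * (s ^+ 2 / th2 ^+ 2).
pose C2 := C1 * expR (- s).
pose C3 := c * (145 * expR (- (th1 * t0))).
have C10 : 0 <= C1 by rewrite mulr_ge0// divr_ge0 ?sqr_ge0.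
have C20 : 0 <= C2 by rewrite mulr_ge0// expR_ge0.
have C30 : 0 <= C3 by rewrite mulr_ge0// mulr_ge0// expR_ge0.
have t12 : 0 <= 2 * th1 by lra.
apply: (@le_trans _ _ (\int[P]_w ((a + C1)%:E + (C2%:E * (soft th2 w)%:E + C3%:E * (soft (2 * th1) w)%:E)))%E).
  apply: ge0_le_integral_nonmeasurable => w; first by rewrite lee_fin.
  rewrite -!EFinM -!EFinD lee_fin.
  have m0 : 0 <= m w.
    by rewrite /m; elim/big_ind: _ => // y z y0 z0; rewrite /Num.max; case: ifP.
  have qm i : `|q i w| <= m w by exact: (le_bigmax _ (fun i => `|q i w|)).
  apply: le_trans (errle w (m w) qm m0) _.
  rewrite -2!addrA lerD2l addrA; apply: lerD.
    apply: le_trans (_ : C1 * (1 + expR (th2 * m w - s)) <= _).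
      rewrite /C1 -mulrA; apply: ler_wpM2l => //.
      have := sqr_le_sqr_expR s2 (mulr_ge0 (ltW t2) m0).
      rewrite exprMn => h; rewrite mulrAC ler_pdivlMr ?exprn_gt0//.
      by rewrite mulrC.
    rewrite mulrDr mulr1 lerD2l expRD mulrA mulrAC /C2; apply: ler_wpM2l => //.
    exact: expRm_le_soft (ltW t2).
  rewrite /C3 -mulrA; apply: ler_wpM2l => //.
  case: ifPn => [tm|_]; last by rewrite !mulr_ge0 ?expR_ge0.
  have h := sqr_le_expR m0.
  have h1 : 1 <= expR (m w) by rewrite -expR0 ler_expR.
  (* [145 = 1 + 36 * 4], the 4 coming from [sqr_le_expR]. *)
  apply: le_trans (_ : 145 * expR (m w) <= _); first by lra.
  rewrite -mulrA ler_pM2l//.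
  (* As [t0 < m w] and [1 <= th1], one has [m w + th1 * t0 <= 2 * th1 * m w]: half of the slope
     absorbs the polynomial factor, the other half yields the tail. *)
  apply: le_trans (_ : expR (- (th1 * t0)) * expR (2 * th1 * m w) <= _).
    rewrite -expRD ler_expR; nra.
  by rewrite ler_wpM2l ?expR_ge0// expRm_le_soft.
rewrite ge0_integralD//; last 3 first.
- by move=> w _; rewrite lee_fin addr_ge0.
- by move=> w _; rewrite -!EFinM -EFinD lee_fin addr_ge0// mulr_ge0.
- by apply: emeasurable_funD; apply: measurable_funeM.
rewrite integral_cst// [X in (_ * X)%E]probability_setT mule1.
rewrite ge0_integralD//; last 4 first.
- by move=> w _; rewrite -!EFinM lee_fin mulr_ge0.
- exact: measurable_funeM.
- by move=> w _; rewrite -!EFinM lee_fin mulr_ge0.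
- exact: measurable_funeM.
rewrite !ge0_integralZl//; last 2 first.
- by move=> w _; rewrite lee_fin.
- by move=> w _; rewrite lee_fin.
apply: (@le_trans _ _ ((a + C1)%:E + (C2%:E * (1 + 2 * #|I|%:R * expR (4 * th2 ^+ 2 * V ^+ 2 / n%:R))%:E
   + C3%:E * (1 + 2 * #|I|%:R * expR (4 * (2 * th1) ^+ 2 * V ^+ 2 / n%:R))%:E))%E).
  apply: leeD2l; apply: leeD; apply: lee_wpmul2l; rewrite ?lee_fin//.
    by apply: expectation_soft => //; exact: ltW.
  exact: expectation_soft.
rewrite -!EFinM -!EFinD lee_fin /C3 /C2 /C1 le_eqVlt; apply/orP; left; apply/eqP.
ring.
Qed.

End Deviation.

(** * Euclidean geometry and operator bounds *)

Section EuclideanGeometry.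
Context (R : realType).

Definition dot (p : nat) (u v : 'cV[R]_p) : R := (u^T *m v) 0 0.

Lemma dotE p (u v : 'cV[R]_p) : dot u v = \sum_i u i 0 * v i 0.
Proof. by rewrite /dot mxE; apply: eq_bigr => i _; rewrite mxE. Qed.

Lemma dotC p (u v : 'cV[R]_p) : dot u v = dot v u.
Proof. by rewrite !dotE; apply: eq_bigr => i _; rewrite mulrC. Qed.

Lemma dotDr p (u v w : 'cV[R]_p) : dot u (v + w) = dot u v + dot u w.
Proof. by rewrite /dot mulmxDr mxE. Qed.

Lemma dotDl p (u v w : 'cV[R]_p) : dot (v + w) u = dot v u + dot w u.
Proof. by rewrite dotC dotDr !(dotC u). Qed.

Lemma dotZr p a (u v : 'cV[R]_p) : dot u (a *: v) = a * dot u v.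
Proof. by rewrite /dot -scalemxAr mxE. Qed.

Lemma dotZl p a (u v : 'cV[R]_p) : dot (a *: v) u = a * dot v u.
Proof. by rewrite dotC dotZr dotC. Qed.

Lemma dotNr p (u v : 'cV[R]_p) : dot u (- v) = - dot u v.
Proof. by rewrite -scaleN1r dotZr mulN1r. Qed.

Lemma dotNl p (u v : 'cV[R]_p) : dot (- v) u = - dot v u.
Proof. by rewrite dotC dotNr dotC. Qed.

Lemma dot0r p (u : 'cV[R]_p) : dot u 0 = 0.
Proof. by rewrite /dot mulmx0 mxE. Qed.

Lemma dot_mulmx p q (A : 'M[R]_(q, p)) (u : 'cV[R]_p) (v : 'cV[R]_q) :
  dot v (A *m u) = dot (A^T *m v) u.
Proof. by rewrite /dot trmx_mul trmxK mulmxA. Qed.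

Lemma qfE p (A : 'M[R]_p) u : qf A u = dot u (A *m u).
Proof. by rewrite /qf /dot mulmxA. Qed.

Lemma dot_ge0 p (u : 'cV[R]_p) : 0 <= dot u u.
Proof. by rewrite dotE sumr_ge0// => i _; rewrite -expr2 sqr_ge0. Qed.

Lemma dot_eq0 p (u : 'cV[R]_p) : (dot u u == 0) = (u == 0).
Proof.
apply/idP/idP => [|/eqP->]; last by rewrite dot0r.
rewrite dotE psumr_eq0; last by move=> i _; rewrite -expr2 sqr_ge0.
move=> /allP H; apply/eqP/matrixP => i j; rewrite ord1 mxE.
have := H i; rewrite mem_index_enum => /(_ isT).
by rewrite mulf_eq0 orbb => /eqP.
Qed.

Local Notation enorm := (@euclidean_norm R _).

Lemma enorm_sqr p (u : 'cV[R]_p) : (enorm u) ^+ 2 = dot u u.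
Proof.
rewrite /euclidean_norm sqr_sqrtr; last by rewrite sumr_ge0// => i _; rewrite sqr_ge0.
by rewrite dotE; apply: eq_bigr => i _; rewrite expr2.
Qed.

Lemma enorm_ge0 p (u : 'cV[R]_p) : 0 <= (enorm u).
Proof. exact: sqrtr_ge0. Qed.

Lemma enorm_le p q (u : 'cV[R]_p) (v : 'cV[R]_q) :
  ((enorm u) <= (enorm v)) = (dot u u <= dot v v).
Proof. by rewrite -!enorm_sqr ler_pXn2r ?nnegrE ?enorm_ge0. Qed.

Lemma enorm_le_real p (u : 'cV[R]_p) (c : R) : 0 <= c ->
  ((enorm u) <= c) = (dot u u <= c ^+ 2).
Proof. by move=> c0; rewrite -!enorm_sqr ler_pXn2r ?nnegrE ?enorm_ge0. Qed.

Lemma enorm_eq0 p (u : 'cV[R]_p) : ((enorm u) == 0) = (u == 0).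
Proof. by rewrite -dot_eq0 -enorm_sqr expf_eq0. Qed.

Lemma enorm0 p : (enorm (0 : 'cV[R]_p)) = 0.
Proof. by apply/eqP; rewrite enorm_eq0. Qed.

Lemma enormZ p a (u : 'cV[R]_p) : (enorm (a *: u)) = `|a| * (enorm u).
Proof.
apply/eqP; rewrite -(@eqrXn2 _ 2) ?mulr_ge0 ?enorm_ge0//.
by rewrite exprMn !enorm_sqr dotZl dotZr mulrA -expr2 real_normK// num_real.
Qed.

Lemma enormN p (u : 'cV[R]_p) : (enorm (- u)) = (enorm u).
Proof. by rewrite -scaleN1r enormZ normrN1 mul1r. Qed.

Lemma cauchy_schwarz p (u v : 'cV[R]_p) : `|dot u v| <= (enorm u) * (enorm v).
Proof.
rewrite -(@ler_pXn2r _ 2) ?nnegrE ?mulr_ge0 ?enorm_ge0//.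
rewrite real_normK ?num_real// exprMn !enorm_sqr.
have [->|v0] := eqVneq v 0; first by rewrite !dot0r mulr0 expr0n.
have vv0 : 0 < dot v v by rewrite lt_def dot_eq0 v0 dot_ge0.
have := dot_ge0 (dot v v *: u - dot u v *: v).
rewrite !(dotDr, dotDl, dotNr, dotNl, dotZr, dotZl) (dotC v u).
rewrite (_ : _ + _ = dot v v * (dot u u * dot v v - dot u v ^+ 2)); last by ring.
by rewrite pmulr_rge0// subr_ge0.
Qed.

Lemma dot_le p (u v : 'cV[R]_p) : dot u v <= (enorm u) * (enorm v).
Proof. exact: le_trans (ler_norm _) (cauchy_schwarz u v). Qed.

Lemma enormD p (u v : 'cV[R]_p) : (enorm (u + v)) <= (enorm u) + (enorm v).
Proof.
rewrite enorm_le_real ?addr_ge0 ?enorm_ge0//.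
rewrite dotDr !dotDl (dotC v u) -!enorm_sqr.
have := dot_le u v; lra.
Qed.

(** An upper bound on the spectral norm in the form of an inequality, which composes without any
    supremum; [spectral_norm] returns only in [spectral_norm_sqr_le]. *)
Definition opbound (m n : nat) (A : 'M[R]_(m, n)) (c : R) :=
  forall x : 'cV[R]_n, (enorm (A *m x)) <= c * (enorm x).

Lemma opbound_le m n (A : 'M[R]_(m, n)) c c' :
  c <= c' -> opbound A c -> opbound A c'.
Proof.
by move=> cc H x; apply: le_trans (H x) _; rewrite ler_wpM2r ?enorm_ge0.
Qed.

Lemma opboundD m n (A B : 'M[R]_(m, n)) a b :
  opbound A a -> opbound B b -> opbound (A + B) (a + b).
Proof.
move=> HA HB x; rewrite mulmxDl mulrDl.
by apply: le_trans (enormD _ _) _; exact: lerD.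
Qed.

Lemma opboundN m n (A : 'M[R]_(m, n)) a : opbound A a -> opbound (- A) a.
Proof. by move=> H x; rewrite mulNmx enormN. Qed.

Lemma opboundB m n (A B : 'M[R]_(m, n)) a b :
  opbound A a -> opbound B b -> opbound (A - B) (a + b).
Proof. by move=> HA HB; apply: opboundD => //; exact: opboundN. Qed.

Lemma opboundM m n l (A : 'M[R]_(m, n)) (B : 'M[R]_(n, l)) a b : 0 <= a ->
  opbound A a -> opbound B b -> opbound (A *m B) (a * b).
Proof.
move=> a0 HA HB x; rewrite -mulmxA -mulrA.
by apply: le_trans (HA _) _; rewrite ler_wpM2l.
Qed.

Lemma opbound_bilinear m n (A : 'M[R]_(m, n)) c : 0 <= c ->
  (forall x y, dot y (A *m x) <= c * (enorm x) * (enorm y)) -> opbound A c.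
Proof.
move=> c0 H x; have := H x (A *m x); rewrite -enorm_sqr expr2.
have [->|A0] := eqVneq ((enorm (A *m x))) 0; first by rewrite mulr_ge0 ?enorm_ge0.
by rewrite ler_pM2r// lt_def A0 enorm_ge0.
Qed.

Lemma spectral_norm_sqr_le m n (A : 'M[R]_(m, n)) c : 0 <= c ->
  opbound A c -> spectral_norm A ^+ 2 <= c ^+ 2.
Proof.
move=> c0 H.
have ub x : (enorm x) <= 1 -> (enorm (A *m x)) <= c.
  move=> x1; apply: le_trans (H x) _; rewrite -[leRHS]mulr1.
  exact: ler_wpM2l.
have mem0 : [set euclidean_norm (A *m x) | x in [set x | euclidean_norm x <= 1]] 0.
  by exists 0; rewrite /= ?mulmx0 enorm0.
rewrite lerXn2r ?nnegrE//.
- rewrite /spectral_norm; apply: ub_le_sup => //.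
  by exists c => _ [x x1 <-]; exact: ub.
- by apply: ge_sup => [|_ [x x1 <-]]; [exists 0|exact: ub].
Qed.

Lemma qf_dotD p (A : 'M[R]_p) (u v : 'cV[R]_p) : A^T = A ->
  qf A (u + v) = qf A u + 2 * dot u (A *m v) + qf A v.
Proof.
move=> As; rewrite !qfE mulmxDr dotDr !dotDl.
rewrite (dot_mulmx A u v) As (dotC (A *m v)); ring.
Qed.

Lemma qfZ p (A : 'M[R]_p) a u : qf A (a *: u) = a ^+ 2 * qf A u.
Proof. by rewrite !qfE -scalemxAr dotZl dotZr mulrA. Qed.

Lemma qfN p (A : 'M[R]_p) u : qf A (- u) = qf A u.
Proof. by rewrite -scaleN1r qfZ sqrrN expr1n mul1r. Qed.

(** Polarization gives a bound by the sum of squared norms; applying it to [|x| y] and [|y| x],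
    which have equal norms, turns the sum into a product. *)
Lemma bilinear_le_of_qf p (A : 'M[R]_p) c : A^T = A -> 0 <= c ->
  (forall u, `|qf A u| <= c * dot u u) ->
  forall x y, dot y (A *m x) <= c * (enorm x) * (enorm y).
Proof.
move=> As c0 H x y.
have key u v : 2 * dot u (A *m v) <= c * (dot u u + dot v v).
  have h1 := H (u + v); have h2 := H (u - v).
  rewrite qf_dotD// in h1; rewrite qf_dotD// qfN mulmxN dotNr in h2.
  rewrite !(dotDr, dotDl) (dotC v u) in h1.
  rewrite !(dotDr, dotDl, dotNr, dotNl) (dotC v u) in h2.
  move: h1 h2; rewrite !ler_norml => /andP[_ h1] /andP[h2 _]; lra.
have [->|x0] := eqVneq x 0; first by rewrite mulmx0 dot0r enorm0 mulr0 mul0r.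
have [->|y0] := eqVneq y 0; first by rewrite dotC dot0r enorm0 mulr0.
have X0 : 0 < (enorm x) by rewrite lt_def enorm_eq0 x0 enorm_ge0.
have Y0 : 0 < (enorm y) by rewrite lt_def enorm_eq0 y0 enorm_ge0.
have := key ((enorm x) *: y) ((enorm y) *: x).
rewrite -scalemxAr !dotZl !dotZr -!enorm_sqr => h.
rewrite -(ler_pM2l X0) -(ler_pM2l Y0) -(@ler_pM2l _ 2)//.
apply: le_trans (le_trans h _); lra.
Qed.

Lemma opbound_of_qf p (A : 'M[R]_p) c : A^T = A -> 0 <= c ->
  (forall u, `|qf A u| <= c * dot u u) -> opbound A c.
Proof.
by move=> As c0 H; apply: opbound_bilinear => //; exact: bilinear_le_of_qf.
Qed.

Lemma unitmx_of_qf p (A : 'M[R]_p) l : 0 < l ->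
  (forall u, l * dot u u <= qf A u) -> A \in unitmx.
Proof.
move=> l0 H; rewrite -row_free_unit; apply: inj_row_free => v vA0.
have := H v^T; rewrite /qf trmxK vA0 mul0mx mxE pmulr_rle0// => h.
apply/eqP; rewrite -trmx_eq0 -dot_eq0 eq_le h; exact: dot_ge0.
Qed.

Lemma opbound_invmx p (A : 'M[R]_p) l : 0 < l ->
  (forall u, l * dot u u <= qf A u) -> opbound (invmx A) l^-1.
Proof.
move=> l0 H x; set u := invmx A *m x.
have Au : A *m u = x by rewrite mulmxA mulmxV ?mul1mx// (unitmx_of_qf l0).
rewrite mulrC ler_pdivlMr// mulrC.
have := le_trans (H u) (_ : qf A u <= (enorm u) * (enorm x)).
rewrite qfE Au dot_le => /(_ isT); rewrite -enorm_sqr expr2 mulrCA.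
have [->|u0] := eqVneq ((enorm u)) 0; first by rewrite mulr0 enorm_ge0.
by rewrite ler_pM2l// lt_def u0 enorm_ge0.
Qed.

End EuclideanGeometry.

(** * Rayleigh quotients *)

Section Rayleigh.
Context (R : realType).
Local Notation enorm := (@euclidean_norm R _).

Lemma opbound_exists m n (A : 'M[R]_(m, n)) : exists2 c, 0 < c & opbound A c.
Proof.
pose F := \sum_i dot (row i A)^T (row i A)^T.
have F0 : 0 <= F by apply: sumr_ge0 => i _; exact: dot_ge0.
exists (F + 1) => [|x]; first by rewrite ltr_wpDl.
rewrite enorm_le_real ?mulr_ge0 ?enorm_ge0 ?addr_ge0// exprMn enorm_sqr.
apply: le_trans (_ : F * dot x x <= _); last first.
  by apply: ler_wpM2r; [exact: dot_ge0|nra].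
rewrite dotE mulr_suml; apply: ler_sum => i _.
have -> : (A *m x) i 0 = dot (row i A)^T x.
  by rewrite mxE dotE; apply: eq_bigr => j _; rewrite !mxE.
rewrite -expr2 -real_normK ?num_real// -!enorm_sqr -exprMn.
rewrite lerXn2r ?nnegrE ?mulr_ge0 ?enorm_ge0//.
exact: cauchy_schwarz.
Qed.

Lemma qf_le_opbound p (A : 'M[R]_p) c u : opbound A c -> `|qf A u| <= c * dot u u.
Proof.
move=> H; rewrite qfE; apply: le_trans (cauchy_schwarz _ _) _.
rewrite -enorm_sqr expr2 mulrC mulrA; apply: ler_wpM2r; first exact: enorm_ge0.
exact: H.
Qed.

Lemma qf_scalar p a (u : 'cV[R]_p) : qf a%:M u = a * dot u u.
Proof. by rewrite qfE mul_scalar_mx dotZr. Qed.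

Lemma qfBl p (A B : 'M[R]_p) u : qf (A - B) u = qf A u - qf B u.
Proof. by rewrite !qfE mulmxBl dotDr dotNr. Qed.

Lemma qfDl p (A B : 'M[R]_p) u : qf (A + B) u = qf A u + qf B u.
Proof. by rewrite !qfE mulmxDl dotDr. Qed.

Lemma qfNl p (A : 'M[R]_p) u : qf (- A) u = - qf A u.
Proof. by rewrite !qfE mulNmx dotNr. Qed.

(** This plays the role of the spectral theorem: it links [lambda_min] and, through [- A],
    [lambda_max], both defined by eigenvalues, to quadratic forms. *)
Lemma rayleigh_min p (A : 'M[R]_p) : (0 < p)%N -> A^T = A ->
  exists2 m, eigenvalue A m & forall u, m * dot u u <= qf A u.
Proof.
case: p A => // p A _ As.
have [c c0 Hc] := opbound_exists A.
pose S := [set qf A u | u in [set u | dot u u = 1]].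
have lbS : lbound S (- c).
  move=> _ [u /= u1 <-]; have := qf_le_opbound u Hc.
  by rewrite u1 mulr1 ler_norml => /andP[].
have S0 : S !=set0.
  exists (qf A (delta_mx 0 0)); exists (delta_mx 0 0) => //=.
  by rewrite /dot trmx_delta mul_delta_mx mxE !eqxx.
have infS : has_inf S by split=> //; exists (- c).
pose m := inf S.
have mP u : m * dot u u <= qf A u.
  have [->|u0] := eqVneq u 0; first by rewrite qfE mulmx0 !dot0r mulr0.
  have n0 : enorm u != 0 by rewrite enorm_eq0.
  have : m <= qf A ((enorm u)^-1 *: u).
    apply: ge_inf; first by exists (- c).
    exists ((enorm u)^-1 *: u) => //=.
    by rewrite dotZl dotZr mulrA -expr2 -enorm_sqr -exprMn mulVf// expr1n.
  rewrite qfZ exprVn enorm_sqr mulrC ler_pdivlMr//.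
  by rewrite lt_def dot_eq0 u0 dot_ge0.
(* If the infimum [m] of the Rayleigh quotient were not an eigenvalue, [A - m]
   would be invertible and nonnegative, hence bounded below by a positive
   constant. *)
exists m => //; apply: contraT => Nm.
pose D := A - m%:M.
have Du : D \in unitmx.
  rewrite -row_free_unit -kermx_eq0; move: Nm.
  by rewrite /eigenvalue /eigenspace negbK.
have Ds : D^T = D by rewrite /D linearB /= As tr_scalar_mx.
have D0 u : 0 <= qf D u by rewrite qfBl qf_scalar subr_ge0.
have [b b0 Hb] := opbound_exists D.
have [g g0 Hg] := opbound_exists (invmx D).
have key x : dot x x <= g ^+ 2 * b * qf D x.
  have h1 : dot x x <= g ^+ 2 * dot (D *m x) (D *m x).
    rewrite -!enorm_sqr -exprMn lerXn2r ?nnegrE ?mulr_ge0 ?enorm_ge0 ?(ltW g0)//.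
    by have := Hg (D *m x); rewrite mulmxA mulVmx ?mul1mx.
  apply: le_trans h1 _; rewrite -mulrA; apply: ler_wpM2l; first by rewrite sqr_ge0.
  (* Nonnegativity of [D] at [x - b^-1 *: (D *m x)], together with the bound [b] on [D], gives
     [|D x|^2 <= b * qf D x]. *)
  have h3 := D0 (x + - b^-1 *: (D *m x)).
  rewrite qf_dotD// -scalemxAr dotZr qfZ dot_mulmx Ds in h3.
  have := qf_le_opbound (D *m x) Hb; rewrite ler_norml => /andP[_ h2].
  have h4 : (- b^-1) ^+ 2 * qf D (D *m x) <= b^-1 * dot (D *m x) (D *m x).
    rewrite sqrrN expr2 -mulrA ler_pM2l ?invr_gt0// mulrC ler_pdivrMr//.
    by rewrite mulrC.
  have h5 : b^-1 * dot (D *m x) (D *m x) <= qf D x by lra.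
  by rewrite mulrC ler_pdivrMr// mulrC in h5.
have gb0 : 0 < g ^+ 2 * b by rewrite mulr_gt0// exprn_gt0.
have : m + (g ^+ 2 * b)^-1 <= m.
  apply: lb_le_inf => // _ [u /= u1 <-].
  have := key u; rewrite u1 qfBl qf_scalar u1 mulr1 mulrC.
  rewrite -ler_pdivrMr// mul1r; lra.
by rewrite gerDl leNgt invr_gt0 gb0.
Qed.

Lemma eigenvalue_qf p (A : 'M[R]_p) l : eigenvalue A l ->
  exists2 u : 'cV[R]_p, u != 0 & qf A u = l * dot u u.
Proof.
move=> /eigenvalueP[v vA v0]; exists v^T; first by rewrite trmx_eq0.
by rewrite /qf /dot trmxK vA -scalemxAl mxE.
Qed.

Lemma lambda_min_qf p (A : 'M[R]_p) u : (0 < p)%N -> A^T = A ->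
  lambda_min A * dot u u <= qf A u.
Proof.
move=> p0 As; have [m mA mP] := rayleigh_min p0 As.
apply: le_trans (mP u); apply: ler_wpM2r; first exact: dot_ge0.
apply: ge_inf => //; exists m => l /= /eigenvalue_qf[v v0 vl].
have := mP v; rewrite vl ler_pM2r// lt_def dot_eq0 v0; exact: dot_ge0.
Qed.

Lemma qf_lambda_max p (A : 'M[R]_p) u : (0 < p)%N -> A^T = A ->
  qf A u <= lambda_max A * dot u u.
Proof.
move=> p0 As; have [|m mA mP] := @rayleigh_min p (- A) p0; first by rewrite linearN /= As.
have mP' v : qf A v <= - m * dot v v by have := mP v; rewrite qfNl; lra.
apply: le_trans (mP' u) _; apply: ler_wpM2r; first exact: dot_ge0.
apply: ub_le_sup.
  exists (- m) => l /= /eigenvalue_qf[v v0 vl].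
  have := mP' v; rewrite vl ler_pM2r// lt_def dot_eq0 v0; exact: dot_ge0.
move/eigenvalueP: mA => [v vA v0] /=; apply/eigenvalueP; exists v => //.
by rewrite scaleNr -vA mulmxN opprK.
Qed.

Lemma le_lambda_min p (A : 'M[R]_p) c : (0 < p)%N -> A^T = A ->
  (forall u, c * dot u u <= qf A u) -> c <= lambda_min A.
Proof.
move=> p0 As H; have [m mA mP] := rayleigh_min p0 As.
apply: lb_le_inf => [|l /= /eigenvalue_qf[v v0 vl]]; first by exists m.
have := H v; rewrite vl ler_pM2r// lt_def dot_eq0 v0; exact: dot_ge0.
Qed.

End Rayleigh.

(** * Tapering as an average of windows *)

Section Tapering.
Context (R : realType).

Lemma qf_sum p (A : 'M[R]_p) (u : 'cV[R]_p) :
  qf A u = \sum_i \sum_j u i 0 * A i j * u j 0.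
Proof.
rewrite qfE dotE; apply: eq_bigr => i _; rewrite mxE mulr_sumr.
by apply: eq_bigr => j _; rewrite mulrA.
Qed.

(** Schur test: [2 |u_i u_j| <= u_i^2 + u_j^2], and by symmetry row and column sums agree. *)
Lemma qf_le_row_sum p (E : 'M[R]_p) c (u : 'cV[R]_p) : E^T = E ->
  (forall j, \sum_i `|E i j| <= c) -> `|qf E u| <= c * dot u u.
Proof.
move=> Es H; rewrite qf_sum.
apply: le_trans (ler_norm_sum _ _ _) _.
apply: (@le_trans _ _ (\sum_i \sum_j `|E i j| * ((u i 0 ^+ 2 + u j 0 ^+ 2) / 2))).
  apply: ler_sum => i _; apply: le_trans (ler_norm_sum _ _ _) _.
  apply: ler_sum => j _; rewrite !normrM mulrAC mulrC; apply: ler_wpM2l => //.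
  rewrite -normrM ler_norml.
  have := sqr_ge0 (u i 0 + u j 0); have := sqr_ge0 (u i 0 - u j 0).
  by rewrite sqrrB sqrrD => h1 h2; apply/andP; split; lra.
have Eij i j : E i j = E j i by rewrite -[in LHS]Es mxE.
have S : \sum_i \sum_j `|E i j| * (u j 0 ^+ 2) <= c * dot u u.
  rewrite exchange_big dotE mulr_sumr /=; apply: ler_sum => j _.
  by rewrite -mulr_suml -expr2; apply: ler_wpM2r; rewrite ?sqr_ge0.
have S' : \sum_i \sum_j `|E i j| * (u i 0 ^+ 2) <= c * dot u u.
  rewrite exchange_big; apply: le_trans S; rewrite le_eqVlt; apply/orP; left.
  by apply/eqP; apply: eq_bigr => i _; apply: eq_bigr => j _; rewrite Eij.
suff -> : \sum_i \sum_j `|E i j| * ((u i 0 ^+ 2 + u j 0 ^+ 2) / 2) =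
    (\sum_i \sum_j `|E i j| * (u i 0 ^+ 2)
     + \sum_i \sum_j `|E i j| * (u j 0 ^+ 2)) / 2.
  by rewrite ler_pdivrMr// mulr_natr mulr2n lerD.
rewrite -big_split /= mulr_suml; apply: eq_bigr => i _.
rewrite -big_split /= mulr_suml; by apply: eq_bigr => j _; field.
Qed.

Lemma sum_interval (N a b : nat) : (b < N)%N ->
  (\sum_(s < N) (a < s <= b) = b - a)%N.
Proof.
move=> bN; suff -> : (\sum_(s < N) (a < s <= b) = minn N.-1 b - a)%N by lia.
elim: N {bN} => [|N IH]; first by rewrite big_ord0; lia.
by rewrite big_ord_recr /= IH; lia.
Qed.

(* With truncated subtraction, [k - c * d] counts the [s] such that
   [c * i < s <= c * i + k] and [c * j < s <= c * j + k] when [d = |i - j|]: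
   the factor [c = 2] is what makes the half-length windows integral. *)
Lemma taper_weightE (k d : nat) : (0 < k)%N ->
  taper_weight R k d = 2 / k%:R * ((k - d)%:R - (k - 2 * d)%:R / 2).
Proof.
move=> k0; have kR : 0 < k%:R :> R by rewrite ltr0n.
have kn : k%:R != 0 :> R by rewrite gt_eqF.
rewrite /taper_weight ler_pdivlMr// -natrM ler_nat.
case: (leqP (d * 2) k) => h1.
  have e1 : (k - d)%:R = k%:R - d%:R :> R by rewrite natrB//; lia.
  have e2 : (k - 2 * d)%:R = k%:R - 2 * d%:R :> R by rewrite natrB ?natrM//; lia.
  by rewrite e1 e2; field.
have -> : (k - 2 * d = 0)%N by lia.
case: (ltnP d k) => h2.
  have e1 : (k - d)%:R = k%:R - d%:R :> R by rewrite natrB//; lia.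
  by rewrite e1; field.
have -> : (k - d = 0)%N by lia.
by rewrite mul0r subr0 mulr0.
Qed.

Context (p k : nat).
Implicit Types (D : 'M[R]_p) (u : 'cV[R]_p).

Definition window (c s : nat) u : 'cV[R]_p :=
  \col_i ((c * i < s <= c * i + k)%N%:R * u i 0).

Lemma sum_qf_window c D u : (0 < c)%N ->
  \sum_(s < c * p + k) qf D (window c s u) =
  \sum_(i < p) \sum_(j < p) u i 0 * ((k - c * `|i%:Z - j%:Z|)%N%:R * D i j) * u j 0.
Proof.
move=> c0; under eq_bigr do rewrite qf_sum.
rewrite exchange_big; apply: eq_bigr => i _.
rewrite exchange_big; apply: eq_bigr => j _.
have <- : (\sum_(s < c * p + k)
    (maxn (c * i) (c * j) < s <= minn (c * i) (c * j) + k)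
    = k - c * `|i%:Z - j%:Z|)%N.
  rewrite sum_interval; last first.
    have := ltn_ord i; rewrite -(ltn_pmul2l c0); lia.
  rewrite -maxnMr -minnMr.
  have -> : (minn i j = maxn i j - `|i%:Z - j%:Z|)%N by lia.
  have : (`|i%:Z - j%:Z| <= maxn i j)%N by lia.
  by move=> h; rewrite mulnBr; have := leq_mul (leqnn c) h; lia.
rewrite natr_sum !mulr_suml mulr_sumr mulr_suml; apply: eq_bigr => s _.
rewrite !mxE.
have -> : (maxn (c * i) (c * j) < s <= minn (c * i) (c * j) + k)%N
    = (c * i < s <= c * i + k)%N && (c * j < s <= c * j + k)%N.
  by apply/idP/idP; lia.
by rewrite -[in RHS]mulnb natrM; ring.
Qed.

(** The window count for the identity matrix: only distance 0 survives, and each coordinate lies in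
    exactly [k] windows. *)
Lemma sum_dot_window c u : (0 < c)%N ->
  \sum_(s < c * p + k) dot (window c s u) (window c s u) = k%:R * dot u u.
Proof.
move=> c0; rewrite (eq_bigr (fun s : 'I__ => qf 1%:M (window c s u))); last first.
  by move=> s _; rewrite qf_scalar mul1r.
rewrite sum_qf_window// dotE mulr_sumr; apply: eq_bigr => i _.
rewrite (bigD1 i)//= big1 => [|j ij]; last by rewrite mxE eq_sym (negbTE ij) !mulr0 mul0r.
by rewrite addr0 mxE eqxx subrr absz0 muln0 subn0 mulr1; ring.
Qed.

Lemma qf_taper D u : (0 < k)%N -> qf (taper k D) u =
  2 / k%:R * (\sum_(s < 1 * p + k) qf D (window 1 s u)
              - (\sum_(s < 2 * p + k) qf D (window 2 s u)) / 2).
Proof.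
move=> k0; rewrite !sum_qf_window// qf_sum mulr_suml -sumrB mulr_sumr.
apply: eq_bigr => i _; rewrite mulr_suml -sumrB mulr_sumr; apply: eq_bigr => j _.
rewrite mxE taper_weightE// mul1n; ring.
Qed.

(** The factor is [3 = 2 / k * (k + k / 2)]: each of the two families of windows has total squared
    norm [k * dot u u]. *)
Lemma qf_taper_le (W : pred 'I_p) D (eta : R) : (0 < k)%N ->
  (forall t (v : 'cV[R]_p), (forall i, v i 0 != 0 -> W i && (t <= i < t + k)%N) ->
     `|qf D v| <= eta * dot v v) ->
  forall u : 'cV[R]_p, (forall i, u i 0 != 0 -> W i) ->
  `|qf (taper k D) u| <= 3 * eta * dot u u.
Proof.
move=> k0 H u uW; have kR : 0 < k%:R :> R by rewrite ltr0n.
have B c s : (0 < c <= 2)%N -> `|qf D (window c s u)| <= eta * dot (window c s u) (window c s u).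
  (* The first index of the window: the least [i] with [s <= c * i + k], a half rounded up when
     [c = 2]. *)
  move=> c2; apply: (H (if c == 1 then s - k else (s - k).+1./2)%N) => i.
  rewrite mxE; case: (boolP (c * i < s <= c * i + k)%N) => [h|]; last by rewrite mul0r eqxx.
  rewrite mul1r => /uW->/=; move: c2 h; case: eqP => [->|c1 c2]; first by lia.
  have -> : c = 2%N by lia.
  lia.
have S c : (0 < c <= 2)%N ->
    `|\sum_(s < c * p + k) qf D (window c s u)| <= eta * k%:R * dot u u.
  move=> c2; apply: le_trans (ler_norm_sum _ _ _) _.
  rewrite -mulrA -(@sum_dot_window c); last by case/andP: c2.
  by rewrite mulr_sumr; apply: ler_sum => s _; exact: B.
rewrite qf_taper// normrM ger0_norm; last by rewrite divr_ge0.
rewrite mulrAC ler_pdivrMr//.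
have := S 1%N isT; have := S 2%N isT.
set a := \sum_(s < _) _; set b := \sum_(s < _) _ => ha hb.
have : `|b - a / 2| <= `|b| + `|a| / 2.
  by apply: le_trans (ler_normB _ _) _; rewrite normrM normfV (ger0_norm (ler0n _ 2)).
lra.
Qed.

End Tapering.

(** * A lattice net of the unit ball *)

Section LatticeNet.
Context (R : realType) (k : nat).
Local Notation enorm := (@euclidean_norm R _).

Let N := (4 * k)%N.

(** With spacing [1 / (4 * sqrt k)], rounding all [k] coordinates moves a point by at most 1/4.
    Indices are shifted by [N = 4 * k], large enough for every coordinate of the unit ball. *)
Definition lattice_pt (m : {ffun 'I_k -> 'I_(2 * N).+1}) : 'cV[R]_k :=
  \col_i (((m i)%:R - N%:R) / (4 * Num.sqrt k%:R)).

(** The integer constraint says that the lattice point lies in the unit ball. *)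
Definition lattice_net :=
  {m : {ffun 'I_k -> 'I_(2 * N).+1} | (\sum_i (`|(m i)%:Z - N%:Z| ^ 2) <= 16 * k)%N}.

Lemma sum_half_pow n :
  \sum_(j < (2 * n).+1) (2^-1 : R) ^+ `|j%:Z - n%:Z| = 3 - 2 * 2^-1 ^+ n.
Proof.
elim: n => [|n IH]; first by rewrite big_ord_recl big_ord0 /= expr0; lra.
have -> : ((2 * n.+1).+1 = ((2 * n).+1).+2)%N by lia.
rewrite big_ord_recl big_ord_recr /= (eq_bigr (fun j : 'I_(2 * n).+1 => (2^-1 : R) ^+ `|j%:Z - n%:Z|)).
  rewrite IH /bump /= subn0.
  rewrite (_ : `|_|%N = n.+1); last by lia.
  by rewrite exprS; field.
by move=> j _; congr (_ ^+ _); rewrite /bump /=; lia.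
Qed.

(* Since [|z| <= z ^ 2] on integers, [1 <= 2 ^ (16 k) * \prod_i 2 ^ - |m i - N|]
   on the net, and the sum of the right-hand side factorizes. *)
Lemma card_lattice_net : (#|{: lattice_net}|%:R : R) <= (2 ^+ 16 * 3) ^+ k.
Proof.
rewrite card_sig -sum1_card natr_sum.
apply: (@le_trans _ _ (\sum_(m : {ffun 'I_k -> 'I_(2 * N).+1})
    2 ^+ (16 * k) * \prod_i (2^-1 : R) ^+ `|(m i)%:Z - N%:Z|)); last first.
  rewrite -mulr_sumr -(bigA_distr_bigA (fun (i : 'I_k) (j : 'I_(2 * N).+1) =>
     (2^-1 : R) ^+ `|j%:Z - N%:Z|)).
  rewrite prodr_const card_ord exprM -exprMn lerXn2r ?nnegrE//.
  - by rewrite mulr_ge0// sumr_ge0// => j _; rewrite exprn_ge0.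
  - rewrite ler_wpM2l// sum_half_pow.
    have : 0 <= (2^-1 : R) ^+ N by rewrite exprn_ge0.
    lra.
rewrite big_mkcond; apply: ler_sum => m _.
case: ifPn => [|_]; last first.
  by rewrite mulr_ge0// prodr_ge0// => i _; rewrite exprn_ge0.
rewrite unfold_in => h.
rewrite prodrXr; set S := (\sum_i _)%N.
have SN : (S <= 16 * k)%N.
  apply: leq_trans h; apply: leq_sum => i _.
  by case: `|_|%N => // a; rewrite -mulnn leq_pmulr.
by rewrite exprVn ler_pdivlMr ?exprn_gt0// mul1r ler_eXn2l// ltr1n.
Qed.

Hypothesis k0 : (0 < k)%N.

Let c : R := 4 * Num.sqrt k%:R.

Let c_gt0 : 0 < c.
Proof. by rewrite mulr_gt0// sqrtr_gt0 ltr0n. Qed.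

Let c_sqr : c ^+ 2 = 16 * k%:R.
Proof. by rewrite exprMn sqr_sqrtr// -natrX. Qed.

Let c_le : c <= N%:R.
Proof.
rewrite -(@ler_pXn2r _ 2) ?nnegrE ?(ltW c_gt0)// c_sqr -natrX -natrM ler_nat.
by rewrite /N; nia.
Qed.

Lemma lattice_pt_net (m : lattice_net) : dot (lattice_pt (val m)) (lattice_pt (val m)) <= 1.
Proof.
case: m => m /= h; rewrite dotE.
under eq_bigr => i _.
  rewrite mxE -/c -expr2 expr_div_n c_sqr.
  have -> : ((m i)%:R - N%:R : R) ^+ 2 = (`|(m i)%:Z - N%:Z| ^ 2)%N%:R.
    case: (leqP N (m i)) => mN.
      by rewrite (_ : `|_|%N = (m i - N)%N); [rewrite natrX natrB|lia].
    rewrite (_ : `|_|%N = (N - m i)%N); last by lia.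
    by rewrite natrX natrB ?(ltnW mN)//; ring.
  over.
rewrite -mulr_suml -natr_sum ler_pdivrMr ?mulr_gt0 ?ltr0n// mul1r -natrM ler_nat.
exact: h.
Qed.

Lemma lattice_net_cover (u : 'cV[R]_k) : dot u u <= 1 ->
  exists m : lattice_net, enorm (u - lattice_pt (val m)) <= 4^-1.
Proof.
move=> u1.
have ui i : `|u i 0| <= 1.
  rewrite -(@ler_pXn2r _ 2) ?nnegrE// expr1n real_normK ?num_real//.
  apply: le_trans u1; rewrite dotE (bigD1 i)//= -expr2 lerDl.
  by rewrite sumr_ge0// => j _; rewrite -expr2 sqr_ge0.
(* Rounding is towards zero, so that the lattice point does not leave the ball. *)
pose t i := Num.truncn (c * `|u i 0|).
have tP i : (t i)%:R <= c * `|u i 0| < (t i).+1%:R.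
  by apply: truncn_itv; rewrite mulr_ge0// ltW.
have tN i : (t i <= N)%N.
  rewrite -(ler_nat R); have /andP[h _] := tP i; apply: le_trans h _.
  apply: le_trans c_le; rewrite -[leRHS]mulr1 ler_pM2l//.
pose g i := if 0 <= u i 0 then (N + t i)%N else (N - t i)%N.
have gN i : (g i < (2 * N).+1)%N by rewrite /g; have := tN i; case: ifP; lia.
pose m : {ffun 'I_k -> 'I_(2 * N).+1} := [ffun i => Ordinal (gN i)].
have absm i : `|(m i)%:Z - N%:Z|%N = t i.
  by rewrite ffunE /= /g; have := tN i; case: ifP; lia.
have hm : (\sum_i (`|(m i)%:Z - N%:Z| ^ 2) <= 16 * k)%N.
  rewrite -(ler_nat R) natr_sum natrM -c_sqr.
  apply: (@le_trans _ _ (c ^+ 2 * dot u u)); last first.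
    by rewrite -[leRHS]mulr1 ler_wpM2l// sqr_ge0.
  rewrite dotE mulr_sumr; apply: ler_sum => i _.
  rewrite absm natrX -expr2 -(real_normK (num_real (u i 0))) -exprMn.
  rewrite lerXn2r ?nnegrE ?mulr_ge0 ?(ltW c_gt0)//.
  by case/andP: (tP i).
exists (exist _ m hm); rewrite enorm_le_real ?invr_ge0//= dotE.
have mu i : ((m i)%:R - N%:R : R) = (if 0 <= u i 0 then 1 else -1) * (t i)%:R.
  rewrite ffunE /= /g; have := tN i; case: ifP => _ h.
    by rewrite natrD; ring.
  by rewrite natrB//; ring.
apply: (@le_trans _ _ (\sum_(i < k) (16 * k%:R)^-1)); last first.
  rewrite sumr_const card_ord -[_ *+ k]mulr_natr invfM -mulrA mulVf ?mulr1.
    by rewrite expr2; lra.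
  by rewrite pnatr_eq0 -lt0n.
apply: ler_sum => i _; rewrite -c_sqr -exprVn -expr2.
rewrite -(real_normK (num_real ((u - _) i 0))) lerXn2r ?nnegrE ?invr_ge0 ?(ltW c_gt0)//.
rewrite !mxE -/c mu.
have /andP[h1 h2] : 0 <= `|u i 0| - (t i)%:R / c <= c^-1.
  have /andP[h1 h2] := tP i; rewrite subr_ge0 ler_pdivrMr// [_ * c]mulrC h1 /=.
  rewrite lerBlDr -[X in X + _]mul1r -mulrDl ler_pdivlMr// mulrC.
  by rewrite addrC natr1 ltW.
case: ifP => u0; rewrite ler_norml.
  by rewrite ger0_norm// in h1 h2; apply/andP; split; lra.
rewrite ltr0_norm in h1 h2; last by rewrite ltNge u0.
by apply/andP; split; lra.
Qed.

Lemma qf_le_lattice_net (D : 'M[R]_k) y : D^T = D ->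
  (forall m : lattice_net, `|qf D (lattice_pt (val m))| <= y) ->
  forall u, `|qf D u| <= 2 * y * dot u u.
Proof.
move=> Ds H.
have [C C0 HC] := opbound_exists D.
pose S := [set `|qf D u| | u in [set u | dot u u = 1]].
have ubS : has_ubound S.
  by exists C => _ [u /= u1 <-]; have := qf_le_opbound u HC; rewrite u1 mulr1.
have S0 : S !=set0.
  pose e : 'cV[R]_k := delta_mx (Ordinal k0) 0.
  exists `|qf D e|; exists e => //=.
  by rewrite /dot trmx_delta mul_delta_mx mxE !eqxx.
set B := sup S.
have HB u : `|qf D u| <= B * dot u u.
  have [->|u0] := eqVneq u 0; first by rewrite qfE mulmx0 !dot0r normr0 mulr0.
  have n0 : enorm u != 0 by rewrite enorm_eq0.
  have : `|qf D ((enorm u)^-1 *: u)| <= B.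
    apply: ub_le_sup => //; exists ((enorm u)^-1 *: u) => //=.
    by rewrite dotZl dotZr mulrA -expr2 -enorm_sqr -exprMn mulVf// expr1n.
  rewrite qfZ exprVn enorm_sqr normrM normfV (ger0_norm (dot_ge0 u)) mulrC ler_pdivrMr//.
  by rewrite lt_def dot_eq0 u0 dot_ge0.
have B0 : 0 <= B.
  have [s [u /= u1 _]] := S0; apply: le_trans (_ : `|qf D u| <= _) => //.
  by have := HB u; rewrite u1 mulr1.
have bB : opbound D B by exact: opbound_of_qf.
(* Self-bounding: replacing [u] by its net point [x] costs [dot (u + x) (D *m (u - x))], at most
   [2 * B / 4]. As [B] is finite, this is absorbed on the left. *)
have : B <= y + B / 2.
  apply: ge_sup => // _ [u /= u1 <-].
  have [m hm] := @lattice_net_cover u (eq_ind_r (fun z => z <= 1) (lexx 1) u1).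
  set x := lattice_pt (val m) in hm *.
  have eN : enorm u <= 1 by rewrite enorm_le_real// u1 expr1n.
  have xN : enorm x <= 1 by rewrite enorm_le_real// expr1n; exact: lattice_pt_net.
  have -> : qf D u = qf D x + dot (u + x) (D *m (u - x)).
    have sw : dot x (D *m u) = dot u (D *m x) by rewrite dot_mulmx Ds dotC.
    rewrite !qfE mulmxBr !(dotDr, dotDl, dotNr) sw; ring.
  apply: le_trans (ler_normD _ _) _; apply: lerD; first exact: H.
  apply: le_trans (cauchy_schwarz _ _) _.
  have h1 := le_trans (enormD u x) (lerD eN xN).
  have h2 := le_trans (bB (u - x)) (ler_wpM2l B0 hm).
  apply: le_trans (ler_pM (enorm_ge0 _) (enorm_ge0 _) h1 h2) _; lra.
move=> BB u; apply: le_trans (HB u) _; apply: ler_wpM2r; first exact: dot_ge0.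
lra.
Qed.

End LatticeNet.

(** * Truncation and perturbation of the regression operator *)

Section OperatorBounds.
Context (R : realType).

Lemma opbound_isometry p b (E : 'M[R]_(p, b)) : E^T *m E = 1%:M -> opbound E 1.
Proof.
by move=> EE x; rewrite mul1r enorm_le dot_mulmx mulmxA EE mul1mx.
Qed.

Lemma opbound_isometry_tr p b (E : 'M[R]_(p, b)) : E^T *m E = 1%:M -> opbound E^T 1.
Proof.
move=> EE; apply: opbound_bilinear => // x y; rewrite mul1r dot_mulmx trmxK dotC.
apply: le_trans (dot_le _ _) _; apply: ler_wpM2l; first exact: enorm_ge0.
by have := opbound_isometry EE y; rewrite mul1r.
Qed.

Lemma qf_congr_mx p b (E : 'M[R]_(p, b)) (A : 'M[R]_p) x :
  qf (E^T *m A *m E) x = qf A (E *m x).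
Proof. by rewrite /qf trmx_mul !mulmxA. Qed.

Lemma dot_isometry p b (E : 'M[R]_(p, b)) x : E^T *m E = 1%:M ->
  dot (E *m x) (E *m x) = dot x x.
Proof. by move=> EE; rewrite dot_mulmx mulmxA EE mul1mx. Qed.

Lemma invmxB n (A B : 'M[R]_n) : A \in unitmx -> B \in unitmx ->
  invmx A - invmx B = invmx A *m (B - A) *m invmx B.
Proof.
by move=> Au Bu; rewrite mulmxBr mulmxBl mulVmx// mul1mx mulmxK.
Qed.

Section Truncation.
Context (p b q : nat) (E : 'M[R]_(p, b)) (EE : E^T *m E = 1%:M).

(** Let [H] be the truncated regression. Since [N] lives on the columns selected by [E], [H *m A]
    equals [N] up to the coupling of kept and dropped coordinates. Hence the difference times [Sxx]
    consists of the two tapering errors and the [kappa] term. *)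
Lemma opbound_regression_truncation (Sxx A : 'M[R]_p) (Syx N : 'M[R]_(q, p))
    (s l tau cN kappa : R) :
  0 < s -> 0 < l -> 0 <= tau -> 0 <= cN -> 0 <= kappa ->
  (forall u, s * dot u u <= qf Sxx u) ->
  (forall u, l * dot u u <= qf (E^T *m A *m E) u) ->
  opbound (Syx - N) tau -> opbound (Sxx - A) tau -> opbound N cN ->
  N *m E *m E^T = N ->
  opbound (N *m E *m invmx (E^T *m A *m E) *m (E^T *m A *m (1%:M - E *m E^T))) kappa ->
  opbound (Syx *m invmx Sxx - N *m E *m invmx (E^T *m A *m E) *m E^T)
    ((tau + cN * l^-1 * tau + kappa) * s^-1).
Proof.
move=> s0 l0 t0 c0 k0 hS hA hSN hSA hN NE hk.
have Su := unitmx_of_qf s0 hS; have Au := unitmx_of_qf l0 hA.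
set Ab := E^T *m A *m E in hA hk Au *.
set Rm := E^T *m A *m (1%:M - E *m E^T) in hk *.
set H := N *m E *m invmx Ab *m E^T.
have HA : H *m A = N + N *m E *m invmx Ab *m Rm.
  have -> : H *m A = N *m E *m invmx Ab *m (Ab *m E^T + Rm).
    rewrite /H -mulmxA; congr (_ *m _).
    by rewrite /Rm /Ab mulmxBr mulmx1 !mulmxA addrC subrK.
  by rewrite mulmxDr -(mulmxA (N *m E)) (mulmxA (invmx Ab)) mulVmx// mul1mx NE.
have -> : Syx *m invmx Sxx - H
    = (Syx - N - H *m (Sxx - A) - N *m E *m invmx Ab *m Rm) *m invmx Sxx.
  rewrite -[X in _ - X](mulmxK Su) -mulmxBl; congr (_ *m _).
  by rewrite mulmxBr HA opprB addrA (addrA (Syx - N)) subrK addrAC addrK.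
have hH : opbound H (cN * l^-1).
  have -> : cN * l^-1 = cN * 1 * l^-1 * 1 by rewrite !mulr1.
  apply: opboundM; last exact: opbound_isometry_tr.
    by rewrite mulr1 mulr_ge0// invr_ge0 ltW.
  apply: opboundM; rewrite ?mulr1//; last exact: opbound_invmx.
  by rewrite -[cN]mulr1; apply: opboundM => //; exact: opbound_isometry.
have cl0 : 0 <= cN * l^-1 by rewrite mulr_ge0// invr_ge0 ltW.
apply: opboundM; last exact: opbound_invmx.
  by rewrite !addr_ge0// mulr_ge0.
apply: opboundB => //; apply: opboundB => //; exact: opboundM.
Qed.

(** First [N] is changed at a fixed inverse, then the inverse is changed by the resolvent identity
    [invmxB]. *)
Lemma opbound_truncated_perturbation (N N' : 'M[R]_(q, p)) (Ab B : 'M[R]_b)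
    (l l' mu delta cN : R) :
  0 < l -> 0 < l' -> 0 <= mu -> 0 <= cN -> 0 <= delta ->
  (forall u, l * dot u u <= qf Ab u) -> (forall u, l' * dot u u <= qf B u) ->
  opbound ((N - N') *m E) mu -> opbound (B - Ab) delta ->
  opbound (N' *m E) cN ->
  opbound (N *m E *m invmx Ab *m E^T - N' *m E *m invmx B *m E^T)
    (mu * l^-1 + cN * (l^-1 * delta * l'^-1)).
Proof.
move=> l0 l'0 mu0 cN0 d0 hA hB hN hBA hN'.
have Au := unitmx_of_qf l0 hA; have Bu := unitmx_of_qf l'0 hB.
have li : 0 <= l^-1 by rewrite invr_ge0 ltW.
have li' : 0 <= l'^-1 by rewrite invr_ge0 ltW.
have -> : N *m E *m invmx Ab *m E^T - N' *m E *m invmx B *m E^T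
  = ((N - N') *m E *m invmx Ab
     + N' *m E *m (invmx Ab *m (B - Ab) *m invmx B)) *m E^T.
  rewrite -mulmxBl; congr (_ *m _).
  by rewrite -invmxB// mulmxBr !mulmxBl addrA subrK.
rewrite -[X in opbound _ X]mulr1; apply: opboundM; last exact: opbound_isometry_tr.
  by rewrite addr_ge0 ?mulr_ge0.
apply: opboundD; apply: opboundM => //; first exact: opbound_invmx.
apply: opboundM; rewrite ?mulr_ge0//; last exact: opbound_invmx.
by apply: opboundM => //; exact: opbound_invmx.
Qed.

Lemma opbound_truncated (N' : 'M[R]_(q, p)) (B : 'M[R]_b) (l' cN : R) :
  0 < l' -> 0 <= cN -> (forall u, l' * dot u u <= qf B u) ->
  opbound (N' *m E) cN -> opbound (N' *m E *m invmx B *m E^T) (cN * l'^-1).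
Proof.
move=> l'0 cN0 hB hN'; rewrite -[X in opbound _ X]mulr1.
apply: opboundM; last exact: opbound_isometry_tr.
  by rewrite mulr_ge0// invr_ge0 ltW.
by apply: opboundM => //; exact: opbound_invmx.
Qed.

End Truncation.

(* Entries of the inverse of a banded positive definite matrix decay
   geometrically away from the diagonal: with [K = 1 - Ab / L] one has
   [Ab^-1 = L^-1 + Ab^-1 K], and each multiplication by the banded matrix [K]
   moves the support of [Y] down by at most [k] rows. *)
Lemma opbound_banded_inverse_corner b q r (k m : nat) (Ab : 'M[R]_b)
    (X : 'M[R]_(q, b)) (Y : 'M[R]_(b, r)) (l L cX cY : R) :
  0 < l -> l < L -> 0 <= cX -> 0 <= cY -> Ab^T = Ab -> (m.+1 * k <= b)%N ->
  (forall u, l * dot u u <= qf Ab u) -> (forall u, qf Ab u <= L * dot u u) ->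
  (forall i j : 'I_b, (k <= `|i%:Z - j%:Z|)%N -> Ab i j = 0) ->
  (forall i (j : 'I_b), (j + k <= b)%N -> X i j = 0) ->
  (forall (i : 'I_b) j, (k <= i)%N -> Y i j = 0) ->
  opbound X cX -> opbound Y cY ->
  opbound (X *m invmx Ab *m Y) (cX * l^-1 * ((1 - l / L) ^+ m * cY)).
Proof.
move=> l0 lL cX0 cY0 As mk hl hL band supX supY hX hY.
have L0 : 0 < L by exact: lt_trans lL.
have Au := unitmx_of_qf l0 hl.
pose K := 1%:M - L^-1 *: Ab.
have rho0 : 0 <= 1 - l / L by rewrite subr_ge0 ler_pdivrMr// mul1r ltW.
have hK : opbound K (1 - l / L).
  apply: opbound_of_qf => // [|u].
    by rewrite /K linearB /= trmx1 linearZ /= As.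
  have -> : qf K u = dot u u - L^-1 * qf Ab u.
    by rewrite /K !qfE mulmxBl mul1mx -scalemxAl dotDr dotNr dotZr.
  have h1 : 0 <= dot u u - L^-1 * qf Ab u.
    by rewrite subr_ge0 mulrC ler_pdivrMr// mulrC.
  rewrite ger0_norm// mulrBl mul1r lerD2l lerN2 mulrAC [leRHS]mulrC.
  by rewrite ler_pM2r ?invr_gt0.
pose Yj j := iter j (mulmx K) Y.
have hYj j : opbound (Yj j) ((1 - l / L) ^+ j * cY).
  elim: j => [|j IH]; first by rewrite expr0 mul1r.
  by rewrite exprS -mulrA; apply: opboundM.
have supYj j (i : 'I_b) c : (j.+1 * k <= i)%N -> Yj j i c = 0.
  elim: j i c => [|j IH] i c; first by rewrite mul1n => /supY.
  move=> hi; rewrite /Yj iterS mxE big1// => a _.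
  have [ha|ha] := leqP (j.+1 * k) a; first by rewrite [X in _ * X]IH// mulr0.
  rewrite !mxE band ?mulr0 ?subr0; last by nia.
  have -> : (i == a) = false by apply/negbTE; apply: contraTneq hi => ->; nia.
  by rewrite mul0r.
have step j : (j <= m)%N -> X *m invmx Ab *m Y = X *m invmx Ab *m Yj j.
  elim: j => // j IH jm; rewrite IH; last by lia.
  (* [Yj j] occupies the first [j.+1 * k] rows and [X] the last [k] columns; they are disjoint as
     long as [j.+2 * k <= b], which [j < m] and the assumption [m.+1 * k <= b] guarantee. *)
  have XY : X *m Yj j = 0.
    apply/matrixP => i c; rewrite !mxE big1// => a _.
    have [ha|ha] := leqP (j.+1 * k) a; first by rewrite supYj// mulr0.
    by rewrite supX ?mul0r//; nia.
  rewrite /Yj iterS -/(Yj j) -!mulmxA /K mulmxBl mul1mx -scalemxAl.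
  by rewrite 2!mulmxBr -2!scalemxAr mulKmx// XY scaler0 subr0.
rewrite (step m)//; apply: opboundM => //.
  by rewrite mulr_ge0// invr_ge0 ltW.
by apply: opboundM => //; exact: opbound_invmx.
Qed.

End OperatorBounds.

(** * Coordinate embeddings and block extraction *)

Section ShiftEmbedding.
Context (R : realType).

(** Columns that would land beyond row [p] are zero, so windows overlapping the border need no
    special case; the map is then a contraction, and an isometry when [t + k <= p]. *)
Definition shift_mx (p k t : nat) : 'M[R]_(p, k) :=
  \matrix_(i, j) (i == (t + j)%N :> nat)%:R.

Lemma shift_mxK p k t (u : 'cV[R]_k) (i : 'I_p) (j : 'I_k) :
  i = (t + j)%N :> nat -> (shift_mx p k t *m u) i 0 = u j 0.
Proof.
move=> ij; rewrite mxE (bigD1 j)//= big1 => [|l lj].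
  by rewrite mxE ij eqxx mul1r addr0.
by rewrite mxE ij eqn_add2l eq_sym val_eqE (negbTE lj) mul0r.
Qed.

Lemma shift_mx_supp p k t (u : 'cV[R]_k) (i : 'I_p) :
  (shift_mx p k t *m u) i 0 != 0 -> (t <= i < t + k)%N.
Proof.
rewrite mxE; apply: contraNT => h; apply/eqP; rewrite big1// => j _.
rewrite mxE; case: eqP => [e|]; last by rewrite mul0r.
by move: h; rewrite e leq_addr ltn_add2l ltn_ord.
Qed.

Lemma shift_mx_tr p k t : (shift_mx p k t)^T *m shift_mx p k t =
  diag_mx (\row_j (t + j < p)%N%:R).
Proof.
apply/matrixP => i j; rewrite !mxE.
have [tp|tp] := boolP (t + i < p)%N.
  rewrite (bigD1 (Ordinal tp))//= big1 => [|l li].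
    by rewrite !mxE /= eqxx mul1r addr0 eqn_add2l val_eqE; case: eqP.
  rewrite !mxE; case: eqP => [e|]; last by rewrite mul0r.
  by case/eqP: li; apply: val_inj.
rewrite big1 ?mul0rn// => l _; rewrite !mxE; case: eqP => [e|]; last by rewrite mul0r.
by move: tp; rewrite -e ltn_ord.
Qed.

Lemma shift_mx_isometry p k t : (t + k <= p)%N ->
  (shift_mx p k t)^T *m shift_mx p k t = 1%:M.
Proof.
move=> tk; rewrite shift_mx_tr -diag_const_mx; congr diag_mx.
apply/matrixP => i j; rewrite !mxE (_ : (_ < _)%N)//.
by have := ltn_ord j; lia.
Qed.

Lemma shift_mx_proj p k t : shift_mx p k t *m (shift_mx p k t)^T =
  diag_mx (\row_i (t <= i < t + k)%N%:R).
Proof.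
apply/matrixP => i j; rewrite !mxE.
have [/andP[h1 h2]|tp] := boolP (t <= i < t + k)%N.
  have h : (i - t < k)%N by lia.
  rewrite (bigD1 (Ordinal h))//= big1 => [|l li].
    by rewrite !mxE /= subnKC// eqxx mul1r addr0 eq_sym val_eqE; case: eqP.
  rewrite !mxE; case: eqP => [e|]; last by rewrite mul0r.
  by case/eqP: li; apply: val_inj; rewrite /= e addKn.
rewrite big1 ?mul0rn// => l _; rewrite !mxE; case: eqP => [e|]; last by rewrite mul0r.
by move: tp; rewrite e leq_addr ltn_add2l ltn_ord.
Qed.

Lemma dot_shift_mx p k t (u : 'cV[R]_k) :
  dot (shift_mx p k t *m u) (shift_mx p k t *m u) <= dot u u.
Proof.
rewrite dot_mulmx mulmxA shift_mx_tr !dotE; apply: ler_sum => i _.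
rewrite mul_diag_mx !mxE; case: (_ < _)%N; first by rewrite mul1r.
by rewrite mul0r mul0r -expr2 sqr_ge0.
Qed.

Lemma shift_mx_window p k t (u : 'cV[R]_p) :
  (forall i, u i 0 != 0 -> (t <= i < t + k)%N) ->
  shift_mx p k t *m ((shift_mx p k t)^T *m u) = u.
Proof.
move=> H; apply/matrixP => i j; rewrite ord1.
have [/andP[h1 h2]|h] := boolP (t <= i < t + k)%N.
  have jk : (i - t < k)%N by lia.
  rewrite (@shift_mxK _ _ _ _ i (Ordinal jk)) /=; last by rewrite subnKC.
  rewrite mxE (bigD1 i)//= big1 => [|l li].
    by rewrite !mxE /= subnKC// eqxx mul1r addr0.
  by rewrite !mxE /= subnKC// val_eqE (negbTE li) mul0r.
have -> : u i 0 = 0 by apply/eqP; apply: contraNT h; exact: H.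
by apply/eqP; apply: contraNT h; exact: shift_mx_supp.
Qed.

End ShiftEmbedding.

(** This trades dependent casts for products with one embedding, so that the operator bounds apply
    to [Lambda]. *)
Lemma castmx_block_drE (R : realType) (c b p : nat) (e : (c + b = p)%N) (X : 'M[R]_b) :
  castmx (e, e) (block_mx 0 0 0 X) = shift_mx R p b c *m X *m (shift_mx R p b c)^T.
Proof.
case: p / e; rewrite castmx_id.
have -> : shift_mx R (c + b) b c = col_mx 0 1%:M.
  apply/matrixP => i j; rewrite !mxE; case: splitP => l e; rewrite !mxE e.
    by case: eqP => // e'; have := ltn_ord l; lia.
  by rewrite eqn_add2l val_eqE.
by rewrite mul_col_mx tr_col_mx trmx0 trmx1 mul_col_row !mul0mx mul1mx mulmx0 mulmx1.
Qed.

Section LowerRightBlock.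
Context (R : realType) (p0 b : nat) (hb : (b <= p0)%N).
Let E := shift_mx R p0 b (p0 - b).

Lemma lower_right_blockE (A : 'M[R]_p0) : lower_right_block hb A = E^T *m A *m E.
Proof.
apply/matrixP => i j; rewrite /lower_right_block /drsubmx mxE [LHS]mxE castmxE.
set i' := cast_ord _ _; set j' := cast_ord _ _.
have ei : i' = (p0 - b + i)%N :> nat by [].
have ej : j' = (p0 - b + j)%N :> nat by [].
rewrite mxE (bigD1 j')//= big1 => [|l lj].
  rewrite addr0 [X in _ * X]mxE ej eqxx mulr1 mxE (bigD1 i')//= big1 => [|l li].
    by rewrite !mxE ei eqxx mul1r addr0.
  by rewrite !mxE -ei val_eqE (negbTE li) mul0r.
by rewrite [X in _ * X]mxE -ej val_eqE (negbTE lj) mulr0.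
Qed.

Lemma LambdaE eps (A : 'M[R]_p0) : let B := E^T *m A *m E in
  Lambda hb eps A =
    E *m invmx (B + (Num.max (eps - lambda_min B) 0)%:M) *m E^T.
Proof. by rewrite /= -lower_right_blockE /Lambda castmx_block_drE. Qed.

End LowerRightBlock.

Section Blocks.
Context (R : realType) (m n : nat).

Lemma dot_col_mx (x x' : 'cV[R]_m) (y y' : 'cV[R]_n) :
  dot (col_mx x y) (col_mx x' y') = dot x x' + dot y y'.
Proof. by rewrite /dot tr_col_mx mul_row_col mxE. Qed.

Lemma mulmx_col_mx0 (A : 'M[R]_(m + n)) (x : 'cV[R]_m) :
  A *m col_mx x (0 : 'cV[R]_n) = col_mx (ulsubmx A *m x) (dlsubmx A *m x).
Proof. by rewrite -[A in LHS]submxK mul_block_col !mulmx0 !addr0. Qed.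

Lemma qf_ulsubmx (A : 'M[R]_(m + n)) (x : 'cV[R]_m) :
  qf (ulsubmx A) x = qf A (col_mx x (0 : 'cV[R]_n)).
Proof. by rewrite !qfE mulmx_col_mx0 dot_col_mx [X in _ + X]dotC dot0r addr0. Qed.

Lemma enorm_col_mx0 (x : 'cV[R]_m) :
  euclidean_norm (col_mx x (0 : 'cV[R]_n)) = euclidean_norm x.
Proof.
apply/eqP; rewrite -(@eqrXn2 _ 2) ?enorm_ge0// !enorm_sqr.
by rewrite dot_col_mx dot0r addr0.
Qed.

Lemma opbound_ulsubmx (A : 'M[R]_(m + n)) c : opbound A c -> opbound (ulsubmx A) c.
Proof.
move=> H x; have := H (col_mx x 0); rewrite enorm_col_mx0 mulmx_col_mx0.
apply: le_trans; rewrite enorm_le dot_col_mx lerDl; exact: dot_ge0.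
Qed.

Lemma opbound_dlsubmx (A : 'M[R]_(m + n)) c : opbound A c -> opbound (dlsubmx A) c.
Proof.
move=> H x; have := H (col_mx x 0); rewrite enorm_col_mx0 mulmx_col_mx0.
apply: le_trans; rewrite enorm_le dot_col_mx lerDr; exact: dot_ge0.
Qed.

Lemma tr_ulsubmx_sym (A : 'M[R]_(m + n)) : A^T = A -> (ulsubmx A)^T = ulsubmx A.
Proof. by move=> As; rewrite -{2}As trmx_ulsub. Qed.

End Blocks.

Section TaperEntries.
Context (R : realType) (k : nat).

Lemma tr_taper n (A : 'M[R]_n) : A^T = A -> (taper k A)^T = taper k A.
Proof. by move=> As; apply/matrixP => i j; rewrite !mxE distnC -{1}As mxE. Qed.

Lemma taperB n (A B : 'M[R]_n) : taper k (A - B) = taper k A - taper k B.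
Proof. by apply/matrixP => i j; rewrite !mxE mulrBr. Qed.

Lemma taper_weight_eq0 d : (0 < k)%N -> (k <= d)%N -> taper_weight R k d = 0.
Proof.
move=> k0 kd; rewrite taper_weightE//.
have -> : (k - d = 0)%N by lia.
have -> : (k - 2 * d = 0)%N by lia.
by rewrite mul0r subr0 mulr0.
Qed.

Lemma mulmx_shift_mx m n l t (A : 'M[R]_(m, n)) (i : 'I_m) (j : 'I_l) (c : 'I_n) :
  c = (t + j)%N :> nat -> (A *m shift_mx R n l t) i j = A i c.
Proof.
move=> cj; rewrite mxE (bigD1 c)//= big1 => [|a ac].
  by rewrite mxE cj eqxx mulr1 addr0.
by rewrite mxE -cj val_eqE (negbTE ac) mulr0.
Qed.

Lemma tr_shift_mx_mulmx m n l t (A : 'M[R]_(n, m)) (i : 'I_m) (j : 'I_l) (c : 'I_n) :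
  c = (t + j)%N :> nat -> ((shift_mx R n l t)^T *m A) j i = A c i.
Proof.
move=> cj; rewrite -[A in LHS]trmxK -trmx_mul mxE (mulmx_shift_mx _ _ cj).
by rewrite mxE.
Qed.

End TaperEntries.

Section TaperedBlocks.
Context (R : realType) (p0 q b k : nat) (hb : (b <= p0)%N) (k0 : (0 < k)%N).
Let p := (p0 + q)%N.
Let E := shift_mx R p0 b (p0 - b).

(** Windows start at [p0 - b], ..., [p0 + k - 1], one copy of the net for each. *)
Definition net_index := ('I_(b + k) * lattice_net k)%type.

Definition net_pt (x : net_index) : 'cV[R]_p :=
  shift_mx R p k (p0 - b + x.1) *m lattice_pt R (val x.2).

Definition corner_pred : pred 'I_p := fun i => (p0 - b <= i < p0 + k)%N.

Lemma qf_le_net (D : 'M[R]_p) y : D^T = D ->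
  (forall x, `|qf D (net_pt x)| <= y) ->
  forall t (v : 'cV[R]_p), (forall i, v i 0 != 0 -> corner_pred i && (t <= i < t + k)%N) ->
  `|qf D v| <= 2 * y * dot v v.
Proof.
move=> Ds H t v hv.
have [->|v0] := eqVneq v 0; first by rewrite qfE mulmx0 !dot0r normr0 mulr0.
have [i0 hi0] : exists i, v i 0 != 0.
  apply/existsP; apply: contraNT v0; rewrite negb_exists => /forallP h.
  by apply/eqP/matrixP => i j; rewrite ord1 mxE; apply/eqP; rewrite -[_ == _]negbK.
(* A window starting before the corner is slid to its edge; the support of [v], which lies in the
   corner, remains covered. *)
pose t1 := maxn t (p0 - b).
have ht1 : (t1 - (p0 - b) < b + k)%N.
  by have := hv _ hi0; rewrite /corner_pred /t1; lia.
pose r := Ordinal ht1.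
have er : (p0 - b + r = t1)%N by rewrite /r /t1 /=; lia.
pose U := shift_mx R p k (p0 - b + r).
have Uv : U *m (U^T *m v) = v.
  apply: shift_mx_window => i /hv; rewrite er /corner_pred /t1; lia.
have := @qf_le_lattice_net R k k0 (U^T *m D *m U) y _ _ (U^T *m v).
rewrite qf_congr_mx Uv -(dot_mulmx U) Uv; apply.
  by rewrite !trmx_mul trmxK Ds mulmxA.
by move=> m; rewrite qf_congr_mx; exact: (H (r, m)).
Qed.

Let maskD (D : 'M[R]_p) : 'M[R]_p :=
  \matrix_(i, j) ((corner_pred i)%:R * taper k D i j * (corner_pred j)%:R).

Let opbound_maskD D y : D^T = D -> 0 <= y ->
  (forall x, `|qf D (net_pt x)| <= y) -> opbound (maskD D) (6 * y).
Proof.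
move=> Ds y0 H; apply: opbound_of_qf; rewrite ?mulr_ge0//.
  apply/matrixP => i j; rewrite ![in LHS]mxE ![in RHS]mxE distnC -{1}Ds mxE; ring.
move=> u; pose u' : 'cV[R]_p := \col_i ((corner_pred i)%:R * u i 0).
have -> : qf (maskD D) u = qf (taper k D) u'.
  by rewrite !qf_sum; apply: eq_bigr => i _; apply: eq_bigr => j _; rewrite !mxE; ring.
apply: le_trans (_ : 3 * (2 * y) * dot u' u' <= _).
  apply: (@qf_taper_le R p k corner_pred) => //; first exact: qf_le_net.
  by move=> i; rewrite mxE; case: corner_pred => //; rewrite mul0r eqxx.
rewrite !mulrA -natrM; apply: ler_wpM2l; first by rewrite mulr_ge0.
rewrite !dotE; apply: ler_sum => i _; rewrite mxE.
case: corner_pred; first by rewrite mul1r.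
by rewrite !mul0r -expr2 sqr_ge0.
Qed.

(* Only windows meeting [corner_pred] matter: below row [p0 + k] the tapered
   cross-covariance vanishes, so masking does not change the block. *)
Lemma opbound_taper_corner (D : 'M[R]_p) y : D^T = D -> 0 <= y ->
  (forall x, `|qf D (net_pt x)| <= y) ->
  opbound (dlsubmx (taper k D) *m E) (6 * y) /\
  opbound (E^T *m ulsubmx (taper k D) *m E) (6 * y).
Proof.
move=> Ds y0 H; have hm := opbound_maskD Ds y0 H.
have EE : E^T *m E = 1%:M by apply: shift_mx_isometry; lia.
have y60 : 0 <= 6 * y by rewrite mulr_ge0.
have cP (j : 'I_b) : exists c : 'I_p0, c = (p0 - b + j)%N :> nat.
  have h : (p0 - b + j < p0)%N by have := ltn_ord j; lia.
  by exists (Ordinal h).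
split.
  have -> : dlsubmx (taper k D) *m E = dlsubmx (maskD D) *m E.
    apply/matrixP => i j; have [c hc] := cP j.
    rewrite !(mulmx_shift_mx _ _ hc) !mxE /corner_pred /= hc.
    have [ik|ik] := ltnP i k.
      rewrite (_ : (_ <= p0 + i < _)%N); last by lia.
      rewrite (_ : (_ <= p0 - b + j < _)%N); last by have := ltn_ord j; lia.
      by rewrite mul1r mulr1.
    by rewrite taper_weight_eq0 ?mul0r ?mulr0 ?mul0r//; have := ltn_ord j; lia.
  rewrite -[6 * y]mulr1; apply: opboundM => //; last exact: opbound_isometry.
  exact: opbound_dlsubmx.
have -> : E^T *m ulsubmx (taper k D) *m E = E^T *m ulsubmx (maskD D) *m E.
  apply/matrixP => i j; have [c hc] := cP j; have [c' hc'] := cP i.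
  rewrite !(mulmx_shift_mx _ _ hc) !(tr_shift_mx_mulmx _ _ hc') !mxE /corner_pred /= hc hc'.
  rewrite (_ : (_ <= p0 - b + i < _)%N); last by have := ltn_ord i; lia.
  rewrite (_ : (_ <= p0 - b + j < _)%N); last by have := ltn_ord j; lia.
  by rewrite mul1r mulr1.
have -> : 6 * y = 1 * (6 * y) * 1 by rewrite mul1r mulr1.
apply: opboundM; rewrite ?mul1r//; last exact: opbound_isometry.
rewrite -[6 * y]mul1r; apply: opboundM => //; first exact: opbound_isometry_tr.
exact: opbound_ulsubmx.
Qed.

End TaperedBlocks.

(** * Bandable matrices *)

Section BandableFacts.
Context (R : realType) (alpha M M0 M1 : R) (p k : nat) (Sigma : 'M[R]_p).
Hypotheses (halpha : 0 < alpha) (hM : 0 < M) (hM1 : 0 < M1)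
  (hS : bandable alpha M M0 M1 Sigma) (p0 : (0 < p)%N) (k0 : (1 < k)%N).

Let Ss : Sigma^T = Sigma. Proof. by case: hS => -[]. Qed.

Let tau := M * (k./2)%:R `^ (- alpha).

Lemma bandable_posdef u : u != 0 -> 0 < qf Sigma u.
Proof. by case: hS => -[_ H _ _ _]; exact: H. Qed.

Lemma bandable_qf_ge u : M1 * dot u u <= qf Sigma u.
Proof.
apply: le_trans (lambda_min_qf u p0 Ss); apply: ler_wpM2r; first exact: dot_ge0.
by case: hS.
Qed.

Lemma bandable_qf_le u : qf Sigma u <= M0 * dot u u.
Proof.
apply: le_trans (qf_lambda_max u p0 Ss) _; apply: ler_wpM2r; first exact: dot_ge0.
by case: hS.
Qed.

Lemma taper_weight_01 d : 0 <= taper_weight R k d <= 1.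
Proof.
have kR : 0 < k%:R :> R by rewrite ltr0n ltnW.
rewrite /taper_weight; case: ifPn => [_|]; first by rewrite ler01 lexx.
rewrite -ltNge => h; case: ifPn => [dk|_]; last by rewrite lexx ler01.
have hk : 0 < k%:R / 2 :> R by rewrite divr_gt0.
rewrite subr_ge0 ler_pdivrMr// lerBlDl -lerBlDr ler_pdivlMr//.
have : d%:R < k%:R :> R by rewrite ltr_nat.
by move=> h'; apply/andP; split; lra.
Qed.

(** Tapering alters only entries at distance more than [k / 2], so the row-sum condition at lag
    [k./2] controls the difference; [1 < k] makes this lag positive. *)
Lemma taper_bias u : `|qf (Sigma - taper k Sigma) u| <= tau * dot u u.
Proof.
apply: qf_le_row_sum; first by rewrite linearB /= tr_taper// Ss.
move=> j; have [_ H _ _] := hS.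
apply: le_trans (H k./2 j _); last by lia.
rewrite [leRHS]big_mkcond; apply: ler_sum => i _; rewrite !mxE.
set w := taper_weight _ _ _.
have -> : Sigma i j - w * Sigma i j = (1 - w) * Sigma i j by ring.
have /andP[w0 w1] : 0 <= w <= 1 by exact: taper_weight_01.
case: ifPn => h.
  rewrite normrM ler_piMl// ger0_norm ?subr_ge0//; lra.
rewrite /w /taper_weight ifT ?subrr ?mul0r ?normr0//.
rewrite ler_pdivlMr// -natrM ler_nat; lia.
Qed.

Hypothesis hk : (4 * M / lambda_min Sigma) `^ alpha^-1 < (k./2)%:R.

Let lam0 : 0 < lambda_min Sigma.
Proof. by apply: lt_le_trans hM1 _; case: hS. Qed.

(** Here the lower bound on [k./2] enters; it keeps the tapered matrix between [3/4 * M1] and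
    [5/4 * M0]. *)
Lemma taper_bias_small : tau <= lambda_min Sigma / 4.
Proof.
have c0 : 0 <= 4 * M / lambda_min Sigma by rewrite divr_ge0 ?mulr_ge0 ?ltW.
have : 4 * M / lambda_min Sigma <= (k./2)%:R `^ alpha.
  have h := ltW hk.
  have := ge0_ler_powR (ltW halpha) _ _ h; rewrite -powRrM mulVf ?gt_eqF// powRr1//.
  by apply; rewrite nnegrE// powR_ge0.
have K0 : 0 < (k./2)%:R `^ alpha by rewrite powR_gt0// ltr0n; lia.
rewrite /tau powRN ler_pdivrMr// => h.
by rewrite ler_pdivrMr// mulrAC ler_pdivlMr// mulrC [leRHS]mulrC.
Qed.

Lemma lambda_min_le_M0 : lambda_min Sigma <= M0.
Proof.
pose e : 'cV[R]_p := delta_mx (Ordinal p0) 0.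
have e1 : dot e e = 1 by rewrite /dot trmx_delta mul_delta_mx mxE !eqxx.
have := le_trans (lambda_min_qf e p0 Ss) (bandable_qf_le e).
by rewrite e1 !mulr1.
Qed.

Lemma qf_taper_ge u : 3 / 4 * M1 * dot u u <= qf (taper k Sigma) u.
Proof.
have := taper_bias u; rewrite qfBl ler_norml => /andP[_ h].
have h1 := lambda_min_qf u p0 Ss; have h2 := dot_ge0 u.
have h3 : tau * dot u u <= lambda_min Sigma / 4 * dot u u.
  by rewrite ler_wpM2r// taper_bias_small.
have h4 : M1 * dot u u <= lambda_min Sigma * dot u u.
  by rewrite ler_wpM2r//; case: hS.
lra.
Qed.

Lemma qf_taper_le_M0 u : qf (taper k Sigma) u <= 5 / 4 * M0 * dot u u.
Proof.
have := taper_bias u; rewrite qfBl ler_norml => /andP[h _].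
have h1 := bandable_qf_le u; have h2 := dot_ge0 u.
have h3 : tau * dot u u <= lambda_min Sigma / 4 * dot u u.
  by rewrite ler_wpM2r// taper_bias_small.
have h4 : lambda_min Sigma * dot u u <= M0 * dot u u.
  by rewrite ler_wpM2r// lambda_min_le_M0.
lra.
Qed.

End BandableFacts.

(** * Deterministic bound on the estimation error *)

Section ConditionalMeanError.
Context (R : realType).

(** The norm bound [1 - l / L] of [1 - Ab / L] for the spectral bounds [l], [L] of the tapered
    matrix. *)
Definition decay_rate (M0 M1 : R) := 1 - 3 / 4 * M1 / (5 / 4 * M0).

(** In order: the squared coefficients of the tapering bias, the inverse decay, the noise
    ([36 = 6 ^ 2]) and the ridge; then, for the bad event, the share of [psi] and that of [phi]. *)
Definition error_constant (M0 M1 : R) :=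
  let l := 3 / 4 * M1 in let L := 5 / 4 * M0 in
  4 * (((1 + L / l) / M1) ^+ 2 + (L * l^-1 * (L * 2) / M1) ^+ 2
    + 36 * (l^-1 + 2 * L * (l^-1 * (2 / M1))) ^+ 2
    + (2 * L * (l^-1 * (2 / M1))) ^+ 2)
  + 2 * (M0 / M1 * (24 / M1)) ^+ 2 + 4 * (L ^+ 2 + 1).

Context (alpha M M0 M1 : R) (p0 q k b m : nat) (hb : (b <= p0)%N)
  (Sigma S : 'M[R]_(p0 + q)) (eps y : R).
Hypotheses (halpha : 0 < alpha) (hM : 0 < M) (hM1 : 0 < M1)
  (hS : bandable alpha M M0 M1 Sigma) (k1 : (1 < k)%N) (b0 : (0 < b)%N)
  (mk : (m.+1 * k <= b)%N)
  (hk : (4 * M / lambda_min Sigma) `^ alpha^-1 < (k./2)%:R)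
  (Ssym : S^T = S) (eps0 : 0 < eps) (y0 : 0 <= y)
  (hy : forall x : net_index b k, `|qf (S - Sigma) (net_pt R p0 q x)| <= y).

Let k0 : (0 < k)%N. Proof. exact: ltnW. Qed.
Let p00 : (0 < p0)%N. Proof. exact: leq_trans hb. Qed.
Let p_gt0 : (0 < p0 + q)%N. Proof. by rewrite addn_gt0 p00. Qed.
Let Sigs : Sigma^T = Sigma. Proof. by case: hS => -[]. Qed.
Let E := shift_mx R p0 b (p0 - b).
Let EE : E^T *m E = 1%:M. Proof. by apply: shift_mx_isometry; rewrite subnK. Qed.
Let l := 3 / 4 * M1.
Let L := 5 / 4 * M0.
Let tau := M * (k./2)%:R `^ (- alpha).
Let A := ulsubmx (taper k Sigma).
Let N := dlsubmx (taper k Sigma).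
Let A' := ulsubmx (taper k S).
Let N' := dlsubmx (taper k S).
Let Ab := E^T *m A *m E.
Let B := E^T *m A' *m E.

Let M10 : M1 <= M0.
Proof.
apply: le_trans (lambda_min_le_M0 hS p_gt0).
by case: hS.
Qed.
Let l0 : 0 < l. Proof. by rewrite /l mulr_gt0. Qed.
Let lL : l < L. Proof. by have h1 := M10; have h2 := hM1; rewrite /l /L; lra. Qed.
Let L0 : 0 < L. Proof. exact: lt_trans lL. Qed.
Let tau0 : 0 <= tau. Proof. by rewrite mulr_ge0 ?powR_ge0// ltW. Qed.
Let mu := 6 * y.
Let mu0 : 0 <= mu. Proof. by rewrite mulr_ge0. Qed.

Let TSs : (taper k Sigma)^T = taper k Sigma. Proof. exact: tr_taper. Qed.
Let As : A^T = A. Proof. exact: tr_ulsubmx_sym. Qed.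
Let Abs : Ab^T = Ab. Proof. by rewrite /Ab !trmx_mul trmxK As mulmxA. Qed.
Let Bs : B^T = B.
Proof. by rewrite /B !trmx_mul trmxK (tr_ulsubmx_sym (tr_taper k Ssym)) mulmxA. Qed.

Let opbound_T : opbound (taper k Sigma) L.
Proof.
apply: opbound_of_qf => // [|u]; first exact: ltW.
have h1 := qf_taper_ge halpha hM hM1 hS p_gt0 k1 hk u.
have h2 := qf_taper_le_M0 halpha hM hM1 hS p_gt0 k1 hk u.
rewrite ger0_norm//; apply: le_trans h1.
by rewrite mulr_ge0 ?dot_ge0// mulr_ge0 ?(ltW hM1)//; lra.
Qed.

Let opbound_bias : opbound (Sigma - taper k Sigma) tau.
Proof.
apply: opbound_of_qf => //; first by rewrite linearB /= TSs Sigs.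
exact: (taper_bias halpha hM hM1 hS p_gt0 k1).
Qed.

Let hAb u : l * dot u u <= qf Ab u.
Proof.
rewrite /Ab qf_congr_mx qf_ulsubmx -(dot_isometry _ EE).
have := qf_taper_ge halpha hM hM1 hS p_gt0 k1 hk (col_mx (E *m u) 0).
by rewrite dot_col_mx dot0r addr0.
Qed.

Let hAbL u : qf Ab u <= L * dot u u.
Proof.
rewrite /Ab qf_congr_mx qf_ulsubmx -(dot_isometry _ EE).
have := qf_taper_le_M0 halpha hM hM1 hS p_gt0 k1 hk (col_mx (E *m u) 0).
by rewrite dot_col_mx dot0r addr0.
Qed.

Let hSxx u : M1 * dot u u <= qf (ulsubmx Sigma) u.
Proof.
rewrite qf_ulsubmx; have := bandable_qf_ge hS p_gt0 (col_mx u 0).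
by rewrite dot_col_mx dot0r addr0.
Qed.

Let hN : opbound N L. Proof. exact: opbound_dlsubmx. Qed.

Let cP (j : 'I_b) : exists c : 'I_p0, c = (p0 - b + j)%N :> nat.
Proof.
have h : (p0 - b + j < p0)%N by have hj := ltn_ord j; clear -hb hj; lia.
by exists (Ordinal h).
Qed.

Let kb : (k <= b)%N.
Proof. by apply: leq_trans mk; rewrite mulSn leq_addr. Qed.

Let NE : N *m E *m E^T = N.
Proof.
rewrite -mulmxA shift_mx_proj mul_mx_diag; apply/matrixP => i j; rewrite [LHS]mxE.
rewrite [X in _ * X]mxE; case: (boolP (_ <= _ < _)%N) => h; first by rewrite mulr1.
rewrite mulr0 !mxE /= taper_weight_eq0 ?mul0r//.
by have hj := ltn_ord j; have hkb := kb; clear -hb h hj hkb; lia.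
Qed.

Let supX (i : 'I_q) (j : 'I_b) : (j + k <= b)%N -> (N *m E) i j = 0.
Proof.
move=> h; have [c hc] := cP j; rewrite (mulmx_shift_mx _ _ hc) !mxE /= hc.
by rewrite taper_weight_eq0 ?mul0r//; clear -hb h; lia.
Qed.

Let Rm := E^T *m A *m (1%:M - E *m E^T).

Let supY (i : 'I_b) (j : 'I_p0) : (k <= i)%N -> Rm i j = 0.
Proof.
move=> ki; have [c hc] := cP i.
rewrite /Rm mulmxBr mulmx1 shift_mx_proj mul_mx_diag mxE [X in _ + X]mxE.
rewrite [X in _ - X]mxE [X in _ - _ * X]mxE.
case: (boolP (_ <= _ < _)%N) => h; first by rewrite mulr1 subrr.
rewrite mulr0 subr0 (tr_shift_mx_mulmx _ _ hc) !mxE /= hc.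
by rewrite taper_weight_eq0 ?mul0r//; have hj := ltn_ord j; clear -hb h hj ki; lia.
Qed.

Let band (i j : 'I_b) : (k <= `|i%:Z - j%:Z|)%N -> Ab i j = 0.
Proof.
move=> h; have [c hc] := cP j; have [c' hc'] := cP i.
rewrite /Ab (mulmx_shift_mx _ _ hc) (tr_shift_mx_mulmx _ _ hc') !mxE /= hc hc'.
by rewrite taper_weight_eq0 ?mul0r//; clear -h; lia.
Qed.

Let kappa := L * l^-1 * (decay_rate M0 M1 ^+ m * (L * 2)).

Let opbound_corner : opbound (N *m E *m invmx Ab *m Rm) kappa.
Proof.
have L0' := ltW L0.
apply: (@opbound_banded_inverse_corner _ _ _ _ k m) => //; first by rewrite mulr_ge0.
  by rewrite -[L]mulr1; apply: opboundM => //; exact: opbound_isometry.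
apply: opboundM => //.
  rewrite -[L]mul1r; apply: opboundM => //; first exact: opbound_isometry_tr.
  exact: opbound_ulsubmx.
apply: opboundB; first by move=> x; rewrite mul1mx mul1r.
rewrite -[1]mulr1; apply: opboundM => //; first exact: opbound_isometry.
exact: opbound_isometry_tr.
Qed.

Let H := N *m E *m invmx Ab *m E^T.

Let opbound_truncation :
  opbound (psi Sigma - H) ((tau + L * l^-1 * tau + kappa) * M1^-1).
Proof.
have rho0 : 0 <= decay_rate M0 M1.
  by rewrite /decay_rate subr_ge0 ler_pdivrMr// mul1r ltW.
apply: opbound_regression_truncation => //.
- exact: ltW.
- have li : 0 <= l^-1 by rewrite invr_ge0 ltW.
  have L0' := ltW L0.
  by rewrite /kappa; apply: mulr_ge0; apply: mulr_ge0 => //; [exact: exprn_ge0|exact: mulr_ge0].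
- rewrite (_ : _ - _ = dlsubmx (Sigma - taper k Sigma)); first exact: opbound_dlsubmx.
  by apply/matrixP => i j; rewrite !mxE.
- rewrite (_ : _ - _ = ulsubmx (Sigma - taper k Sigma)); first exact: opbound_ulsubmx.
  by apply/matrixP => i j; rewrite !mxE.
Qed.

Let TD := taper k (S - Sigma).

Let SSs : (S - Sigma)^T = S - Sigma.
Proof. by rewrite linearB /= Ssym Sigs. Qed.

Let hTD : opbound (dlsubmx TD *m E) mu /\ opbound (E^T *m ulsubmx TD *m E) mu.
Proof. exact: opbound_taper_corner. Qed.

Let TDE : TD = taper k S - taper k Sigma. Proof. exact: taperB. Qed.

Let hNN : opbound ((N - N') *m E) mu.
Proof.
have -> : (N - N') *m E = - (dlsubmx TD *m E).
  rewrite -mulNmx; congr (_ *m _); apply/matrixP => i j.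
  by rewrite TDE !mxE opprB.
by apply: opboundN; case: hTD.
Qed.

Let hBA : opbound (B - Ab) mu.
Proof.
have -> : B - Ab = E^T *m ulsubmx TD *m E.
  rewrite -mulmxBl -mulmxBr; congr (_ *m _ *m _); apply/matrixP => i j.
  by rewrite TDE !mxE.
by case: hTD.
Qed.

Let hN'E : opbound (N' *m E) (L + mu).
Proof.
have -> : N' *m E = N *m E - (N - N') *m E by rewrite -mulmxBl opprB addrC subrK.
apply: opboundB => //; rewrite -[L]mulr1; apply: opboundM => //.
  exact: ltW.
exact: opbound_isometry.
Qed.

Let c := Num.max (eps - lambda_min B) 0.

Let c0 : 0 <= c. Proof. by rewrite le_max lexx orbT. Qed.

Let qfBc u : qf (B + c%:M) u = qf B u + c * dot u u.
Proof. by rewrite qfDl qf_scalar. Qed.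

Let qfBc_ge u : eps * dot u u <= qf (B + c%:M) u.
Proof.
rewrite qfBc; have h1 := lambda_min_qf u b0 Bs.
have h2 : eps - lambda_min B <= c by rewrite le_max lexx.
have h3 := ler_wpM2r (dot_ge0 u) h2.
lra.
Qed.

Let phiE : phi hb k eps S = N' *m E *m invmx (B + c%:M) *m E^T.
Proof. by rewrite /phi LambdaE !mulmxA. Qed.

(** The smallest eigenvalue of [B] is at least [M1 / 2 > 0], so the ridge [c] is at most [eps]. It
    acts as one more perturbation of [Ab], and the [eps ^+ 2] term of the risk comes from it. *)
Let good : mu <= M1 / 4 ->
  opbound (H - phi hb k eps S)
    (mu * l^-1 + (2 * L) * (l^-1 * (mu + eps) * (M1 / 2)^-1)).
Proof.
move=> mus; rewrite phiE.
have qB u : M1 / 2 * dot u u <= qf B u.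
  have := qf_le_opbound u hBA; rewrite qfBl ler_norml => /andP[h1 _].
  have h2 := hAb u; have h3 := ler_wpM2r (dot_ge0 u) mus.
  by rewrite /l in h2; lra.
have lB : M1 / 2 <= lambda_min B by exact: le_lambda_min.
have ceps : c <= eps.
  rewrite ge_max (ltW eps0) andbT; have := hM1; lra.
apply: opbound_truncated_perturbation => //.
- by rewrite divr_gt0.
- by rewrite mulr_ge0// ltW.
- by rewrite addr_ge0// ltW.
- move=> u; rewrite qfBc; apply: le_trans (qB u) _.
  by rewrite lerDl mulr_ge0// dot_ge0.
- rewrite addrAC; apply: opboundD => // x; rewrite mul_scalar_mx enormZ ger0_norm//.
  by rewrite ler_wpM2r ?enorm_ge0.
- apply: opbound_le hN'E; have h1 := lL; have h2 := M10; have h3 := hM1.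
  by rewrite /L; lra.
Qed.

(** Without control of [B], the ridge alone keeps the inverse below [eps^-1]. *)
Let bad : opbound (psi Sigma - phi hb k eps S) (M0 * M1^-1 + (L + mu) * eps^-1).
Proof.
have M00 : 0 <= M0 by apply: le_trans M10; exact: ltW.
apply: opboundB.
  apply: opboundM => //; last exact: opbound_invmx.
  apply: opbound_dlsubmx; apply: opbound_of_qf => // u.
  have h1 := bandable_qf_ge hS p_gt0 u.
  rewrite ger0_norm ?(bandable_qf_le hS p_gt0)//; apply: le_trans h1.
  by rewrite mulr_ge0 ?dot_ge0// ltW.
rewrite phiE; apply: opbound_truncated => //.
by rewrite addr_ge0// ltW.
Qed.

Lemma conditional_mean_error :
  spectral_norm (psi Sigma - phi hb k eps S) ^+ 2 <=
  error_constant M0 M1 * (tau ^+ 2 + (decay_rate M0 M1 ^+ m) ^+ 2 + eps ^+ 2)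
  + error_constant M0 M1 * y ^+ 2
  + error_constant M0 M1 / eps ^+ 2 * (if M1 / 24 < y then 1 + 36 * y ^+ 2 else 0).
Proof.
set C := error_constant M0 M1.
have L0' := L0; have l0' := l0.
have li : 0 <= l^-1 by rewrite invr_ge0 ltW.
have M1i : 0 <= M1^-1 by rewrite invr_ge0 ltW.
have M00 : 0 <= M0 by apply: le_trans M10; exact: ltW.
have rho0 : 0 <= decay_rate M0 M1 ^+ m.
  apply: exprn_ge0.
  by rewrite /decay_rate subr_ge0 ler_pdivrMr// mul1r ltW.
set rho := _ ^+ m in rho0 *.
set a1 := (1 + L / l) / M1; set a2 := L * l^-1 * (L * 2) / M1.
set a3 := l^-1 + 2 * L * (l^-1 * (2 / M1)).
set a4 := 2 * L * (l^-1 * (2 / M1)).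
have CE : C = 4 * (a1 ^+ 2 + a2 ^+ 2 + 36 * a3 ^+ 2 + a4 ^+ 2)
  + 2 * (M0 / M1 * (24 / M1)) ^+ 2 + 4 * (L ^+ 2 + 1) by [].
have sq0 (z : R) : 0 <= z ^+ 2 by exact: sqr_ge0.
have C1 : 4 * a1 ^+ 2 <= C.
  by have := sq0 a2; have := sq0 a3; have := sq0 a4; have := sq0 L;
    have := sq0 (M0 / M1 * (24 / M1)); rewrite CE; lra.
have C2 : 4 * a2 ^+ 2 <= C.
  by have := sq0 a1; have := sq0 a3; have := sq0 a4; have := sq0 L;
    have := sq0 (M0 / M1 * (24 / M1)); rewrite CE; lra.
have C3 : 4 * (36 * a3 ^+ 2) <= C.
  by have := sq0 a1; have := sq0 a2; have := sq0 a4; have := sq0 L;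
    have := sq0 (M0 / M1 * (24 / M1)); rewrite CE; lra.
have C4 : 4 * a4 ^+ 2 <= C.
  by have := sq0 a1; have := sq0 a2; have := sq0 a3; have := sq0 L;
    have := sq0 (M0 / M1 * (24 / M1)); rewrite CE; lra.
have C5 : 2 * (M0 / M1 * (24 / M1)) ^+ 2 <= C.
  by have := sq0 a1; have := sq0 a2; have := sq0 a3; have := sq0 a4; have := sq0 L;
    rewrite CE; lra.
have C6 : 4 * L ^+ 2 + 4 <= C.
  by have := sq0 a1; have := sq0 a2; have := sq0 a3; have := sq0 a4;
    have := sq0 (M0 / M1 * (24 / M1)); rewrite CE; lra.
have C0 : 0 <= C by have := sq0 a1; lra.
have eps_sqr : 0 < eps ^+ 2 by rewrite exprn_gt0.
case: ltP => hy24.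
  apply: le_trans (spectral_norm_sqr_le _ bad) _.
    apply: addr_ge0; apply: mulr_ge0 => //; last by rewrite invr_ge0 ltW.
    by apply: addr_ge0 => //; exact: ltW.
  apply: le_trans (_ : 2 * (M0 * M1^-1) ^+ 2 + 2 * ((L + mu) * eps^-1) ^+ 2 <= _).
    by have := sq0 (M0 * M1^-1 - (L + mu) * eps^-1); rewrite sqrrB sqrrD; lra.
  apply: lerD.
    (* The norm of [psi] carries no factor [1 / eps]; it is charged to the noise instead, since
       [1 <= (24 / M1 * y) ^+ 2] on this event. *)
    apply: le_trans (_ : C * y ^+ 2 <= _); last first.
      by rewrite lerDr mulr_ge0// !addr_ge0.
    apply: le_trans (ler_wpM2r (sq0 y) C5).
    rewrite -[leRHS]mulrA ler_pM2l// [X in _ <= X * _]exprMn -[leRHS]mulrA -exprMn.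
    apply: ler_peMr => //; rewrite -(expr1n _ 2) lerXn2r ?nnegrE//.
      by rewrite mulr_ge0// divr_ge0// ltW.
    rewrite mulrAC ler_pdivlMr ?mul1r//.
    by move: hy24; rewrite ltr_pdivrMr//; lra.
  rewrite [leRHS]mulrAC ler_pdivlMr//.
  rewrite (_ : _ * eps ^+ 2 = 2 * (L + mu) ^+ 2); last by field; rewrite gt_eqF.
  apply: le_trans (ler_wpM2r _ C6); last first.
    by have := sq0 y; lra.
  rewrite -subr_ge0 (_ : _ - _ = 2 * (L - mu) ^+ 2 + 4 + 144 * (L ^+ 2 * y ^+ 2)).
    by rewrite !addr_ge0// mulr_ge0// mulr_ge0.
  by rewrite /mu; ring.
have mus : mu <= M1 / 4 by rewrite /mu; lra.
have := opboundD opbound_truncation (good mus).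
rewrite addrA subrK => hb'; rewrite mulr0 addr0.
apply: le_trans (spectral_norm_sqr_le _ hb') _.
  have L0'' := ltW L0; have e0 := ltW eps0.
  have M2i : 0 <= (M1 / 2)^-1 by rewrite invr_ge0 divr_ge0// ltW.
  have k0' : 0 <= kappa by rewrite /kappa; apply: mulr_ge0; apply: mulr_ge0 => //; exact: mulr_ge0.
  apply: addr_ge0.
    apply: mulr_ge0 => //; apply: addr_ge0 => //; apply: addr_ge0 => //.
    by apply: mulr_ge0 => //; exact: mulr_ge0.
  apply: addr_ge0; first exact: mulr_ge0.
  by apply: mulr_ge0; [exact: mulr_ge0|apply: mulr_ge0 => //; apply: mulr_ge0 => //; exact: addr_ge0].
rewrite [X in X ^+ 2](_ : _ = a1 * tau + a2 * rho + a3 * mu + a4 * eps); last first.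
  by rewrite /a1 /a2 /a3 /a4 /kappa -/rho; field; rewrite !gt_eqF.
set x1 := a1 * tau; set x2 := a2 * rho; set x3 := a3 * mu; set x4 := a4 * eps.
apply: le_trans (_ : 4 * (x1 ^+ 2 + x2 ^+ 2 + x3 ^+ 2 + x4 ^+ 2) <= _).
  have := sq0 (x1 - x2); have := sq0 (x1 - x3); have := sq0 (x1 - x4).
  have := sq0 (x2 - x3); have := sq0 (x2 - x4); have := sq0 (x3 - x4).
  by nra.
have := ler_wpM2r (sq0 tau) C1; have := ler_wpM2r (sq0 rho) C2.
have := ler_wpM2r (sq0 y) C3; have := ler_wpM2r (sq0 eps) C4.
by rewrite /x1 /x2 /x3 /x4 /mu !exprMn; lra.
Qed.

End ConditionalMeanError.

(** * Rates *)

Section RateEstimates.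
Context (R : realType).

Lemma akfloor_le (a : R) k : 0 < a -> (akfloor a k)%:R <= a * k%:R * ln (k%:R : R).
Proof.
move=> a0; rewrite /akfloor truncn_le//.
case: k => [|k]; first by rewrite mulr0 mul0r.
by rewrite !mulr_ge0 ?(ltW a0)// ln_ge0// ler1n.
Qed.

Lemma akfloor_gt (a : R) k : a * k%:R * ln (k%:R : R) < (akfloor a k)%:R + 1.
Proof. by rewrite natr1 truncnS_gt. Qed.

(** The left side is at most [(2 * a + 1) * k ^ 2], while [exp k >= (k / 3) ^ 3]; the two compare
    once [k >= 27 * (2 * a + 1)]. *)
Lemma dimension_le_expR (a : R) : 0 < a -> exists K1 : nat, forall k, (K1 <= k)%N ->
  (2 * akfloor a k + k)%:R <= expR (k%:R : R).
Proof.
move=> a0; exists (Num.truncn (27 * (2 * a + 1))).+1 => k hk.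
have k0 : (0 < k)%N by apply: leq_trans hk.
have kR : 1 <= k%:R :> R by rewrite ler1n.
have hk' : 27 * (2 * a + 1) <= k%:R.
  by apply: le_trans (ltW (truncnS_gt _)) _; rewrite ler_nat.
have lnk : ln (k%:R : R) <= k%:R.
  by have := @ln_sublinear R k%:R; rewrite ltr0n => /(_ k0) /ltW.
have h1 := akfloor_le k a0.
have h2 : a * k%:R * ln (k%:R : R) <= a * k%:R * k%:R.
  by apply: ler_wpM2l => //; rewrite mulr_ge0// ltW.
rewrite natrD natrM.
apply: le_trans (_ : (2 * a + 1) * k%:R ^+ 2 <= _).
  rewrite expr2; nra.
have -> : k%:R = 3 * (k%:R / 3) :> R by field.
rewrite expRM_natl.
apply: le_trans (_ : (k%:R / 3) ^+ 3 <= _); last first.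
  rewrite lerXn2r ?nnegrE ?divr_ge0 ?expR_ge0//.
  by apply: le_trans (expR_ge1Dx _); rewrite lerDr.
rewrite -subr_ge0 (_ : _ - _ = (k%:R / 3) ^+ 2 * (k%:R / 3 - 9 * (2 * a + 1))); last by field.
by rewrite mulr_ge0 ?sqr_ge0//; lra.
Qed.

Lemma powR_le_exponent (k : nat) (x y : R) : (0 < k)%N -> x <= y ->
  (k%:R : R) `^ x <= k%:R `^ y.
Proof. by move=> k0 xy; rewrite ler_powR// ler1n. Qed.

Lemma bias_rate (alpha M : R) (k : nat) x : 0 < alpha -> (1 < k)%N ->
  (M * (k./2)%:R `^ (- alpha)) ^+ 2
    <= M ^+ 2 * 3 `^ (2 * alpha) * k%:R `^ (- 2 * Num.min alpha x).
Proof.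
move=> alpha0 k1; have k0 : (0 < k)%N by exact: ltnW.
rewrite exprMn -mulrA ler_wpM2l ?sqr_ge0//.
(* The constant 3 is sharp at [k = 3]; it produces the factor [3 powR (2 * alpha)]. *)
have h : k%:R / 3 <= (k./2)%:R :> R.
  by rewrite ler_pdivrMr// -natrM ler_nat; lia.
have kR : 0 < k%:R / 3 :> R by rewrite divr_gt0// ltr0n.
have k2 : 0 < (k./2)%:R :> R by rewrite ltr0n; lia.
rewrite -powR_mulrn ?powR_ge0// -powRrM.
apply: le_trans (_ : (k%:R / 3) `^ (- alpha * 2) <= _).
  rewrite mulNr !powRN lef_pV2 ?posrE ?powR_gt0//.
  by apply: ge0_ler_powR => //; rewrite ?nnegrE ?mulr_ge0 ?(ltW alpha0) ?(ltW kR).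
have -> : (k%:R / 3) `^ (- alpha * 2) = 3 `^ (2 * alpha) * k%:R `^ (- 2 * alpha).
  rewrite powRM ?invr_ge0// mulrC; congr (_ * _ `^ _); last by ring.
  by rewrite -powR_inv1// -powRrM; congr (_ `^ _); ring.
rewrite ler_wpM2l ?powR_ge0// powR_le_exponent//.
have hmin : Num.min alpha x <= alpha by rewrite ge_min lexx.
lra.
Qed.

Lemma decay_exponent (a rho x : R) (k : nat) : 0 < a -> 0 < rho -> rho < 1 ->
  (0 < k)%N -> k%:R <= (akfloor a k)%:R / 2 :> R ->
  exists2 m, (m.+1 * k <= 2 * akfloor a k)%N &
  (rho ^+ m) ^+ 2 <= expR (8 * - ln rho) *
     k%:R `^ (- 2 * Num.min x (a * (2 * - ln rho) - 1)).
Proof.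
move=> a0 rho0 rho1 k0 hk; set r := - ln rho.
have kR : 0 < k%:R :> R by rewrite ltr0n.
have kR1 : 1 <= k%:R :> R by rewrite ler1n.
have r0 : 0 < r by rewrite oppr_gt0 ln_lt0// rho0.
set b := (2 * akfloor a k)%N.
have kb : (2 * k <= akfloor a k)%N.
  by rewrite -(ler_nat R) natrM; move: hk; rewrite ler_pdivlMr// mulrC.
have q1 : (0 < b %/ k)%N by rewrite divn_gt0// /b; lia.
exists (b %/ k).-1; first by rewrite prednK// leq_divM.
set m := (_.-1).
(* Of the 4 units lost, two come from the division by [k] and the choice of [m], two bound the
   effect of the floor in [akfloor]. After squaring they give the constant [expR (8 * - ln rho)]. *)
have hm : 2 * (a * ln (k%:R : R)) - 4 <= m%:R.
  have h1 : b%:R < (m.+2)%:R * k%:R :> R.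
    by rewrite -natrM ltr_nat /m prednK// ltn_ceil.
  have := akfloor_gt a k; rewrite /b natrM in h1 => h2.
  rewrite -natr1 -natr1 in h1.
  have h3 : 2 * (a * k%:R * ln (k%:R : R)) < (m%:R + 1 + 1) * k%:R + 2 * k%:R by lra.
  rewrite -(ler_pM2r kR); nra.
have -> : rho ^+ m = expR (- (m%:R * r)).
  by rewrite /r mulrN opprK expRM_natl lnK// posrE.
rewrite -expRM_natl.
have -> : k%:R `^ (- 2 * Num.min x (a * (2 * r) - 1)) =
    expR (- 2 * Num.min x (a * (2 * r) - 1) * ln (k%:R : R)).
  by rewrite /powR gt_eqF.
rewrite -expRD ler_expR.
have lnk : 0 <= ln (k%:R : R) by rewrite ln_ge0.
have hmin : Num.min x (a * (2 * r) - 1) <= a * (2 * r) - 1 by rewrite ge_min lexx orbT.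
have h4 := ler_wpM2r lnk hmin.
have h5 := ler_wpM2r (ltW r0) hm.
lra.
Qed.

End RateEstimates.

(** * Choice of constants and the risk bound *)

Lemma error_constant_gt0 (R : realType) (M0 M1 : R) : 0 < error_constant M0 M1.
Proof.
rewrite /error_constant; apply: ltr_wpDl; last first.
  by rewrite mulr_gt0// ltr_wpDl// sqr_ge0.
by do ?[exact: sqr_ge0 | exact: ler0n | apply: addr_ge0 | apply: mulr_ge0].
Qed.

Lemma tr_sample_covariance (R : realType) (p n : nat) (d : measure_display)
    (T : measurableType d) (P : probability T R)
    (Z : 'I_n -> {RV P >-> p.-tuple R}) w :
  (sample_covariance Z w)^T = sample_covariance Z w.
Proof.
rewrite /sample_covariance linearZ /= linear_sum /=; congr (_ *: _).
by apply: eq_bigr => i _; rewrite trmx_mul trmxK.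
Qed.

(* The net on [b + k <= exp k] windows has at most [exp (net_growth * k)]
   points. *)
Definition net_growth (R : realType) : R := 1 + 2 ^+ 16 * 3.

(* The slope [delta] of the exponential moment [exp (delta * n * |q|)] used on the
   bad event: [16 * delta * M0 ^+ 2 = t0 / 4], where [t0 = M1 / 24], so that the
   Gaussian moment [exp (16 * delta ^+ 2 * M0 ^+ 2 * n)] only costs a quarter of
   the gain [exp (- delta * t0 * n)]. *)
Definition tail_slope (R : realType) (M0 M1 : R) := M1 / (1536 * M0 ^+ 2).

(** Of the exponential gain of the bad event, one quarter pays for the Gaussian moment and one for
    the net; half remains. *)
Definition risk_rate (R : realType) (M0 M1 : R) :=
  tail_slope M0 M1 * (M1 / 24) / 2.

(** The summands belong to tapering, inverse decay, ridge, sampling noise and bad event;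
    [435 = 145 * 3]. *)
Definition risk_constant (R : realType) (alpha M M0 M1 : R) :=
  error_constant M0 M1 *
    (M ^+ 2 * 3 `^ (2 * alpha) + expR (8 * - ln (decay_rate M0 M1)) + 1
     + 4 * (net_growth R + 6) ^+ 2 * M0 ^+ 2 + 435).

Lemma risk_sum_le (R : realType) (kb kd ks x u e y : R) :
  0 <= kb -> 0 <= kd -> 0 <= ks -> 0 <= x -> 0 <= u -> 0 <= e -> 0 <= y ->
  kb * x + kd * x + e + ks * u + 435 * y
    <= (kb + kd + 1 + ks + 435) * (x + u + e + y).
Proof.
move=> b0 d0 s0 x0 u0 e0 y0; rewrite -subr_ge0.
rewrite (_ : _ - _ = kb * (u + e + y) + kd * (u + e + y) + (x + u + y)
  + ks * (x + e + y) + 435 * (x + u + e)); last by ring.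
by do ?[assumption | exact: ler0n | apply: addr_ge0 | apply: mulr_ge0].
Qed.

Lemma risk_le (R : realType) (alpha M M0 M1 : R) (p0 q k n : nat) (a eps : R)
    (Sigma : 'M[R]_(p0 + q)) (d : measure_display) (T : measurableType d)
    (P : probability T R) (Z : 'I_n -> {RV P >-> (p0 + q).-tuple R})
    (hb : (2 * akfloor a k < p0)%N) :
  0 < alpha -> 0 < M -> 0 < M1 -> M1 < M0 -> 0 < a -> 0 < eps ->
  bandable alpha M M0 M1 Sigma -> iid_centered_gaussian Sigma Z ->
  (4 * M / lambda_min Sigma) `^ alpha^-1 < (k./2)%:R ->
  k%:R <= (akfloor a k)%:R / 2 :> R ->
  (2 * akfloor a k + k)%:R <= expR (k%:R : R) ->
  (0 < n)%N -> 16 * k%:R <= n%:R :> R ->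
  net_growth R * k%:R <= tail_slope M0 M1 * (M1 / 24) / 4 * n%:R ->
  1 <= tail_slope M0 M1 * n%:R ->
  ('E_P[fun w => ((spectral_norm
        (psi Sigma - phi (ltnW hb) k eps (sample_covariance Z w))) ^+ 2)%R]
   <= (risk_constant alpha M M0 M1 * (k%:R `^ (- 2 * Num.min alpha (a * (2 * - ln (decay_rate M0 M1)) - 1))
              + k%:R / n%:R
              + eps ^+ 2
              + (p0 + q)%:R `^ 2^-1 * 5 `^ (k%:R / 2)
                * expR (- risk_rate M0 M1 * n%:R) / eps ^+ 2))%:E)%E.
Proof.
move=> halpha hM hM1 hM10 a0 eps0 hS hZ hk hak hdim n0 hn1 hn2 hn3.
set C0 := error_constant M0 M1.
set g := net_growth R in hn2 *.
set delta := tail_slope M0 M1 in hn2 hn3 *.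
set t0 := M1 / 24 in hn2 *.
set rho := decay_rate M0 M1.
have rateE : risk_rate M0 M1 = delta * t0 / 2 by [].
have k1 : (1 < k)%N.
  have : 0 < (k./2)%:R :> R by apply: le_lt_trans hk; exact: powR_ge0.
  by rewrite ltr0n; clear; lia.
have k0 : (0 < k)%N by exact: ltnW.
have kR : 0 < k%:R :> R by rewrite ltr0n.
have kR1 : 1 <= k%:R :> R by rewrite ler1n.
have nR : 0 < n%:R :> R by rewrite ltr0n.
have M00 : 0 < M0 by exact: lt_trans hM10.
have rho1 : rho < 1.
  by rewrite /rho /decay_rate gtrDl oppr_lt0 divr_gt0// mulr_gt0.
have rho0 : 0 < rho.
  rewrite /rho /decay_rate subr_gt0 ltr_pdivrMr ?mulr_gt0// mul1r.
  by have h1 := hM1; have h2 := hM10; lra.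
have pq0 : (0 < p0 + q)%N by rewrite addn_gt0 (leq_ltn_trans _ hb).
set b := (2 * akfloor a k)%N in hb hdim *.
have [m mk hm] := @decay_exponent R a rho alpha k a0 rho0 rho1 k0 hak.
have b0 : (0 < b)%N by apply: leq_trans mk; rewrite muln_gt0.
have Ss : Sigma^T = Sigma by case: hS => -[].
rewrite unlock.
pose tau := M * (k./2)%:R `^ (- alpha).
pose aa := C0 * (tau ^+ 2 + (rho ^+ m) ^+ 2 + eps ^+ 2).
(* With [th2] of order [sqrt (k * n)] the Gaussian moment is [expR (4 * k)] and the net has at most
   [expR (g * k)] points. The cut-off [s] exceeds the sum of both exponents, and [s ^+ 2 / th2 ^+ 2]
   is of order [k / n]. *)
pose s := (g + 6) * k%:R.
pose th1 := delta * n%:R.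
pose th2 := Num.sqrt (k%:R * n%:R) / M0.
have th2_sqr : th2 ^+ 2 = k%:R * n%:R / M0 ^+ 2.
  by rewrite /th2 expr_div_n sqr_sqrtr// mulr_ge0.
have C00 : 0 <= C0 by exact/ltW/error_constant_gt0.
have g0 : 1 <= g by rewrite /g /net_growth lerDl.
have eps2 : 0 < eps ^+ 2 by rewrite exprn_gt0.
have hsym w : (sample_covariance Z w - Sigma)^T = sample_covariance Z w - Sigma.
  by rewrite linearB /= tr_sample_covariance Ss.
have hV x : qf Sigma (@net_pt R p0 q b k x) <= M0.
  apply: le_trans (bandable_qf_le hS pq0 _) _.
  rewrite -[leRHS]mulr1 ler_pM2l// /net_pt.
  apply: le_trans (dot_shift_mx _ _ _) _; exact: lattice_pt_net.
have := @expectation_le_of_deviation R d T P (p0 + q) n Sigma Z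
  {: net_index b k} (@net_pt R p0 q b k) M0 hZ n0 (bandable_posdef hS) hV
  (fun w => spectral_norm (psi Sigma - phi (ltnW hb) k eps (sample_covariance Z w)) ^+ 2)
  aa C0 (C0 / eps ^+ 2) t0 s th1 th2.
move=> H; apply: le_trans (H _ _ _ _ _ _ _ _ _ _) _ => {H}.
- by move=> w; rewrite sqr_ge0.
- move=> w y hy y0.
  exact: (@conditional_mean_error R alpha M M0 M1 p0 q k b m (ltnW hb) Sigma
    (sample_covariance Z w) eps y halpha hM hM1 hS k1 b0 mk hk
    (tr_sample_covariance Z w) eps0 y0 hy).
- by rewrite mulr_ge0// !addr_ge0// sqr_ge0.
- exact: C00.
- by rewrite divr_ge0// ltW.
- rewrite /s; apply: le_trans (_ : (g + 6) * 1 <= _); first by lra.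
  by rewrite ler_wpM2l//; lra.
- exact: hn3.
- by rewrite divr_gt0// sqrtr_gt0 mulr_gt0.
- rewrite /th1 /delta /tail_slope.
  rewrite (_ : _ * M0 = M1 / M0 * (n%:R / 768)); last by field; rewrite gt_eqF.
  apply: le_trans (_ : 1 * (n%:R / 768) <= _); last by lra.
  apply: ler_wpM2r; first by apply: divr_ge0; exact: ler0n.
  by rewrite ler_pdivrMr// mul1r ltW.
- rewrite /th2 divfK ?gt_eqF//.
  rewrite -(@ler_pXn2r _ 2) ?nnegrE ?sqrtr_ge0 ?divr_ge0// sqr_sqrtr; last by rewrite mulr_ge0.
  rewrite -subr_ge0 (_ : _ - _ = n%:R * (n%:R - 16 * k%:R) / 16); last by field.
  by rewrite divr_ge0// mulr_ge0// subr_ge0.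
pose Nn : R := #|{: net_index b k}|%:R.
have hN : Nn <= expR (g * k%:R).
  rewrite /Nn card_prod card_ord natrM.
  apply: le_trans (ler_pM (ler0n _ _) (ler0n _ _) hdim (card_lattice_net R k)) _.
  rewrite /g /net_growth mulrDl mul1r expRD ler_pM2l ?expR_gt0//.
  rewrite [X in expR X]mulrC expRM_natl lerXn2r ?nnegrE ?expR_ge0//.
  by apply: le_trans (expR_ge1Dx _); rewrite lerDr.
have N0 : 0 <= Nn by rewrite ler0n.
have E2 : expR (- s) * (1 + 2 * Nn * expR (4 * th2 ^+ 2 * M0 ^+ 2 / n%:R)) <= 3.
  have -> : 4 * th2 ^+ 2 * M0 ^+ 2 / n%:R = 4 * k%:R.
    by rewrite th2_sqr; field; rewrite !gt_eqF.
  rewrite mulrDr mulr1 (_ : 3 = 1 + 2 :> R); last by ring.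
  apply: lerD.
    rewrite -[leRHS]expR0 ler_expR oppr_le0 mulr_ge0//; lra.
  rewrite mulrCA -mulrA -[leRHS]mulr1 ler_pM2l//.
  apply: le_trans (_ : expR (g * k%:R) * (expR (- s) * expR (4 * k%:R)) <= _).
    by rewrite ler_wpM2r// mulr_ge0 ?expR_ge0.
  rewrite -!expRD -[leRHS]expR0 ler_expR /s; lra.
have E3 : expR (- (th1 * t0)) * (1 + 2 * Nn * expR (4 * (2 * th1) ^+ 2 * M0 ^+ 2 / n%:R))
    <= 3 * expR (- risk_rate M0 M1 * n%:R).
  have dM : 16 * delta * M0 ^+ 2 = t0 / 4.
    by rewrite /delta /tail_slope /t0; field; rewrite gt_eqF.
  have -> : 4 * (2 * th1) ^+ 2 * M0 ^+ 2 / n%:R = delta * t0 / 4 * n%:R.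
    rewrite (_ : delta * t0 / 4 = delta * (t0 / 4)); last by rewrite mulrA.
    by rewrite -dM /th1; field; rewrite gt_eqF.
  have dt0 : 0 <= delta * t0 / 4 * n%:R.
    by apply: le_trans hn2; rewrite mulr_ge0//; lra.
  rewrite mulrDr mulr1 (_ : 3 = 1 + 2 :> R); last by ring.
  rewrite [leRHS]mulrDl mul1r; apply: lerD.
    rewrite ler_expR rateE /th1; lra.
  rewrite [leLHS]mulrCA -[leLHS]mulrA ler_pM2l//.
  apply: le_trans (_ : expR (g * k%:R) * (expR (- (th1 * t0)) * expR (delta * t0 / 4 * n%:R)) <= _).
    by rewrite ler_wpM2r// mulr_ge0 ?expR_ge0.
  rewrite -!expRD ler_expR rateE /th1; have h2 := hn2; lra.
set K := k%:R `^ _.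
set Q := (p0 + q)%:R `^ 2^-1 * 5 `^ (k%:R / 2) * _ / eps ^+ 2.
have K0 : 0 <= K by exact: powR_ge0.
(* The powers of [p] and of 5 in the target are at least 1. *)
have Q0 : expR (- risk_rate M0 M1 * n%:R) / eps ^+ 2 <= Q.
  rewrite /Q ler_pM2r ?invr_gt0//.
  rewrite -[leLHS]mul1r ler_pM2r ?expR_gt0//.
  rewrite -[leLHS]mulr1; apply: ler_pM => //.
    by rewrite -[leLHS](powRr0 (p0 + q)%:R) ler_powR// ler1n.
  by rewrite -[leLHS](powRr0 5) ler_powR// ?divr_ge0// ler1n.
have h1 := bias_rate M (a * (2 * - ln rho) - 1) halpha k1.
rewrite lee_fin /risk_constant -/C0 -/rho -/g.
set Kb := M ^+ 2 * 3 `^ (2 * alpha) in h1 *.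
set Kd := expR (8 * - ln rho) in hm *.
have Kb0 : 0 <= Kb by rewrite mulr_ge0 ?sqr_ge0 ?powR_ge0.
have Kd0 : 0 <= Kd by exact: expR_ge0.
set Ks := 4 * (g + 6) ^+ 2 * M0 ^+ 2.
have Ks0 : 0 <= Ks by do ?[exact: sqr_ge0 | exact: ler0n | apply: mulr_ge0].
have kn0 : 0 <= k%:R / n%:R :> R by rewrite divr_ge0.
have e20 := ltW eps2.
have Qp : 0 <= Q by apply: le_trans Q0; rewrite divr_ge0 ?expR_ge0.
have T1 : aa <= C0 * (Kb * K + Kd * K + eps ^+ 2).
  by rewrite /aa ler_wpM2l// lerD2r lerD.
have T2 : C0 * (s ^+ 2 / th2 ^+ 2 * (1 + expR (- s) *
    (1 + 2 * Nn * expR (4 * th2 ^+ 2 * M0 ^+ 2 / n%:R)))) <= C0 * (Ks * (k%:R / n%:R)).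
  apply: ler_wpM2l => //.
  apply: le_trans (_ : s ^+ 2 / th2 ^+ 2 * 4 <= _).
    apply: ler_wpM2l; first by rewrite divr_ge0 ?sqr_ge0.
    by rewrite (_ : 4 = 1 + 3 :> R) ?lerD2l//; ring.
  rewrite th2_sqr /s /Ks le_eqVlt; apply/orP; left; apply/eqP.
  by field; rewrite !gt_eqF.
have T3 : C0 / eps ^+ 2 * (145 * expR (- (th1 * t0)) *
    (1 + 2 * Nn * expR (4 * (2 * th1) ^+ 2 * M0 ^+ 2 / n%:R))) <= C0 * (435 * Q).
  rewrite -mulrA; apply: ler_wpM2l => //.
  apply: le_trans (_ : 435 * (expR (- risk_rate M0 M1 * n%:R) / eps ^+ 2) <= _).
    rewrite -[X in _ * X]mulrA mulrCA (_ : 435 = 145 * 3 :> R); last by ring.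
    rewrite -[leRHS]mulrA; apply: ler_wpM2l; first exact: ler0n.
    by rewrite mulrC mulrA ler_pM2r ?invr_gt0.
  by apply: ler_wpM2l; first exact: ler0n.
apply: le_trans (lerD (lerD T1 T2) T3) _.
rewrite -!mulrDr -mulrA ler_wpM2l//.
exact: risk_sum_le.
Qed.

Lemma risk_constant_gt0 (R : realType) (alpha M M0 M1 : R) :
  0 < risk_constant alpha M M0 M1.
Proof.
apply: mulr_gt0; first exact: error_constant_gt0.
apply: ltr_wpDl; last by rewrite ltr0n.
by do ?[exact: sqr_ge0 | exact: ler0n | exact: powR_ge0 | exact: expR_ge0
       | apply: addr_ge0 | apply: mulr_ge0].
Qed.

Unset Implicit Arguments.
Set Strict Implicit.
Set Printing Implicit Defensive.

Theorem theorem2p4 (R : realType) (alpha M M0 M1 : R)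
    (halpha : 0 < alpha) (hM : 0 < M) (hM1 : 0 < M1) (hM10 : M1 < M0) :
  exists C lambda tau : R, [/\ 0 < C, 0 < lambda & 0 < tau] /\
  forall a : R, 0 < a ->
  exists K1 P1 : nat,
  forall (p0 q k : nat -> nat) (eps : nat -> R)
    (Sigma0 : forall n, 'M[R]_(p0 n + q n))
    (d : nat -> measure_display) (T : forall n, measurableType (d n))
    (P : forall n, probability (T n) R)
    (Z : forall n, 'I_n -> {RV (P n) >-> (p0 n + q n).-tuple R}),
    (forall n, [/\ (0 < p0 n)%N, (0 < q n)%N, (0 < k n)%N & 0 < eps n]) ->
    (forall n, bandable alpha M M0 M1 (Sigma0 n)) ->
    (forall n, iid_centered_gaussian (Sigma0 n) (@Z n)) ->
    (fun n => Num.max (k n)%:R (ln ((p0 n + q n)%:R : R)))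
      =o_\oo (fun n => n%:R : R) ->
    (forall n,
      (4 * M / lambda_min (Sigma0 n)) `^ alpha^-1 < ((k n)./2)%:R) ->
    eps =O_\oo (fun=> 1 : R) ->
  exists N1 : nat, forall n : nat,
    (N1 <= n)%N -> (K1 <= k n)%N -> (P1 <= p0 n)%N ->
    (k n)%:R <= (akfloor a (k n))%:R / 2 :> R ->
    forall hb : (2 * akfloor a (k n) < p0 n)%N,
    ('E_(P n)[fun w => ((spectral_norm
        (psi (Sigma0 n)
         - phi (ltnW hb) (k n) (eps n) (sample_covariance (@Z n) w))) ^+ 2)%R]
     <= (C * ((k n)%:R `^ (- 2 * Num.min alpha (a * tau - 1))
              + (k n)%:R / n%:R
              + eps n ^+ 2
              + (p0 n + q n)%:R `^ 2^-1 * 5 `^ ((k n)%:R / 2)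
                * expR (- lambda * n%:R) / eps n ^+ 2))%:E)%E.
Proof.
have hM0 : 0 < M0 by exact: lt_trans hM10.
set rho := decay_rate M0 M1.
have rho1 : rho < 1.
  by rewrite /rho /decay_rate gtrDl oppr_lt0 divr_gt0// mulr_gt0.
have rho0 : 0 < rho.
  by rewrite /rho /decay_rate subr_gt0 ltr_pdivrMr ?mulr_gt0// mul1r; lra.
have d0 : 0 < tail_slope M0 M1.
  rewrite /tail_slope; apply: divr_gt0; first exact: hM1.
  apply: mulr_gt0; last exact: exprn_gt0.
  by rewrite ltr0n.
have g0 : 0 < net_growth R.
  by rewrite /net_growth ltr_wpDr// mulr_ge0// exprn_ge0.
have lam0 : 0 < tail_slope M0 M1 * (M1 / 24) by rewrite mulr_gt0// divr_gt0.
(* A block of size [b] has about [2 * a * ln k] bands of width [k], and [rho] to that power is [k]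
   to the power [- a * tau] with [tau = 2 * - ln rho]. *)
exists (risk_constant alpha M M0 M1), (risk_rate M0 M1), (2 * - ln rho); split.
  split.
  - exact: risk_constant_gt0.
  - by rewrite /risk_rate divr_gt0.
  - by rewrite mulr_gt0// oppr_gt0 ln_lt0// rho0.
move=> a a0; have [K1 hK1] := dimension_le_expR a0.
exists K1, 0%N => p0 q k eps Sigma0 d T P Z pos hS hZ ho hk _.
(* The bound [k <= n / 16] keeps the slope [th2] in the range of the Gaussian moment bound; the
   second entry lets a quarter of the exponential gain absorb the net. *)
pose e := Num.min (16^-1) (tail_slope M0 M1 * (M1 / 24) / 4 / net_growth R).
have e0 : 0 < e.
  by rewrite lt_min invr_gt0 ltr0n /= divr_gt0// divr_gt0.
have /eqoP/(_ e e0)[N _ hN] := ho.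
(* The second entry ensures [1 <= tail_slope M0 M1 * n], that is [1 <= th1]. *)
exists (maxn N (Num.truncn (tail_slope M0 M1)^-1).+1) => n.
rewrite geq_max => /andP[/hN hn nd] kK _ hak hb.
have n0 : (0 < n)%N by apply: leq_trans nd.
have [_ _ kn0 epsn0] := pos n.
have {}hn : (k n)%:R <= e * n%:R.
  move: hn => /=; rewrite (ger0_norm (ler0n _ n)); apply: le_trans.
  by apply: le_trans (ler_norm _); rewrite le_max lexx.
apply: risk_le => //.
- exact: hK1.
- have : e <= 16^-1 by rewrite ge_min lexx.
  move=> /(ler_wpM2r (ler0n R n)) /(le_trans hn).
  by rewrite ler_pdivlMl// mulrC.
- have : e <= tail_slope M0 M1 * (M1 / 24) / 4 / net_growth R by rewrite ge_min lexx orbT.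
  move=> /(ler_wpM2r (ler0n R n)) /(le_trans hn).
  by rewrite mulrAC ler_pdivlMr// mulrC.
- rewrite mulrC -ler_pdivrMr// mul1r; apply: le_trans (ltW (truncnS_gt _)) _.
  by rewrite ler_nat.
Qed.
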